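(* Let $\Delta\subset M\otimes\mathbb{R}$ be a reflexive polytope, $\Sigma^*$ the face fan of $\Delta$ and $\Sigma$ the normal fan of $\Delta$. If every cone of $\Sigma^*$ is $\mathbb{Z}_2$ regular, then the spectral sequence $(\overline{E}^r,\overline{d}^r)$ of $X_\Sigma$ collapses at $\overline{E}^1$, i.e. $\overline{d}^r_{p,q}=0$ for all $r\ge1$ and all $p,q$.
   Context: $N\cong\mathbb{Z}^d$ and $M=\mathrm{Hom}(N,\mathbb{Z})$ are dual lattices with pairing $\langle\cdot,\cdot\rangle$; $\mathbb{Z}_2=\mathbb{Z}/2\mathbb{Z}$. A lattice polytope $\Delta\subset M\otimes\mathbb{R}$ of dimension $d$ is reflexive if $0\in\mathrm{int}\,\Delta$ and the polar polytope $\Delta^*=\{n\in N\otimes\mathbb{R}: \langle m,n\rangle\ge -1 \text{ for all } m\in\Delta\}$ is a lattice polytope (with respect to $N$). The face fan of $\Delta$ consists of $\{0\}$ and the cones over proper nonempty faces of $\Delta$. The normal fan $\Sigma$ of $\Delta$ is the inner normal fan; for $\Delta$ reflexive it equals the face fan of $\Delta^*$. A cone $\sigma$ of $\Sigma^*$ (in $M\otimes\mathbb{R}$) is $\mathbb{Z}_2$ regular if the images in $M/2M$ of the primitive lattice generators of its rays form a basis of the subspace $(M\cap\mathrm{span}\,\sigma)/(2M\cap\mathrm{span}\,\sigma)$ of $M/2M$. The spectral sequence. For $\sigma\in\Sigma$ put $N_\sigma=(N\cap\mathrm{span}\,\sigma)/(2N\cap\mathrm{span}\,\sigma)\subset N/2N$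 and $N(\sigma)=(N/2N)/N_\sigma$. For a face $\sigma<\tau$ let $\varpi_{\tau,\sigma}:N(\sigma)\to N(\tau)$ be the quotient map. The moment map gives a cell structure on $X_\Sigma(\mathbb{R})$ with cells $(f,t)$, $f$ a face of $\Delta$ and $t\in N(\sigma)$, where $\sigma\in\Sigma$ is dual to $f$. Its cellular chain complex with $\mathbb{Z}_2$ coefficients is $C_j(X_\Sigma(\mathbb{R}))=\bigoplus_{\dim\sigma=d-j}\mathbb{Z}_2[N(\sigma)]$ (group algebras), with boundary the direct sum over $\sigma$ of $\sum_{\sigma<\tau,\ \dim\tau=d-j+1}(\varpi_{\tau,\sigma})_*$. Let $I_\sigma$ be the augmentation ideal of $\mathbb{Z}_2[N(\sigma)]$ (with $I_\sigma^k$ the whole algebra for $k\le0$). Then $F_pC_j(X_\Sigma(\mathbb{R}))=\bigoplus_{\dim\sigma=d-j}I_\sigma^{d-p}$ defines an increasing filtration by subcomplexes; let $(\widetilde{E}^r,\widetilde{d}^r)$ be the associated homology spectral sequence, $\widetilde{E}^1_{p,q}=H_{p+q}(F_pC_*/F_{p-1}C_* )\Rightarrow H_{p+q}(X_\Sigma(\mathbb{R});\mathbb{Z}_2)$. The spectral sequence $(\overline{E}^r,\overline{d}^r)$ is its reindexing $\overline{E}^r_{p,q}=\widetilde{E}^r_{d-q,\,p+q-d}$, with $\overline{d}^r_{p,q}:\overline{E}^r_{p,q}\to\overline{E}^r_{p-1,q+r}$. *)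

(* Defs.v *)
From HB Require Import structures.
From mathcomp Require Import all_boot all_order all_algebra all_fingroup.
From mathcomp Require Import falgebra generic_quotient ring_quotient finmap.
From mathcomp Require Import boolp classical_sets cardinality reals.
From mathcomp Require Import topology normedtype zify.

Set Implicit Arguments.
Unset Strict Implicit.
Unset Printing Implicit Defensive.

Import Order.TTheory GRing.Theory Num.Theory.
Import numFieldNormedType.Exports.

Local Open Scope classical_set_scope.
Local Open Scope ring_scope.

Section LinearSpan.
Variables (K : fieldType) (V : vectType K).
Implicit Types (S : set V) (U W : {vspace V}).

Definition is_linspan S U :=
  (forall x, S x -> x \in U) /\
  (forall W, (forall x, S x -> x \in W) -> (U <= W)%VS).

Definition linspan S : {vspace V} := xget 0%VS (is_linspan S).

Lemma linspanP S : is_linspan S (linspan S).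
Proof.
apply: (@xgetPex _ 0%VS).
have ex0 : exists n : nat, `[< exists2 U : {vspace V},
    (forall x, S x -> x \in U) & \dim U = n >].
  exists (\dim {:V}); apply/asboolP; exists fullv => // x _; exact: memvf.
have [n /asboolP[U SU dU] minU] := ex_minnP ex0.
exists U; split=> // W SW; apply/capv_idPl/eqP.
rewrite eqEdim capvSl /= dU; apply: minU; apply/asboolP.
by exists (U :&: W)%VS => // x Sx; rewrite memv_cap SU ?SW.
Qed.

Lemma linspan_vspace U : linspan [set x | x \in U] = U.
Proof.
have [h1 h2] := linspanP [set x | x \in U].
apply/eqP; rewrite eqEsubv h2 //=.
by apply/subvP => x xU; apply: h1.
Qed.

End LinearSpan.

Section Convexity.
Variables (R : realType) (V : vectType R).
Implicit Types P F S : set V.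

Definition conv_hull (s : seq V) : set V :=
  [set x | exists a : 'I_(size s) -> R,
     [/\ forall i, 0 <= a i, \sum_i a i = 1 & x = \sum_i a i *: s`_i]].

(* For u = 0 this is P itself. When u is unbounded below on P, as can happen
   for a cone, the set of minimisers is empty. *)
Definition is_face P F :=
  exists u : {scalar V}, F = [set x | P x /\ forall y, P y -> u x <= u y].

(* F is intended to be convex. *)
Definition cone_over F : set V :=
  [set x | exists t : R, exists2 y, F y & 0 <= t /\ x = t *: y].

Definition face_fan P : set (set V) :=
  [set C | C = [set 0] \/
     exists F, [/\ is_face P F, F <> P, F !=set0 & C = cone_over F]].

Definition dim_span S : nat := \dim (linspan S).

End Convexity.

(* M is the lattice of integral row vectors and N the lattice of integral
   column vectors, an element of M acting on N by matrix multiplication. *)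
Section Lattice.
Variables (R : realType) (m n : nat).
Implicit Types (P C : set 'M[R]_(m, n)) (v w : 'M[int]_(m, n)).

Definition lat_real v : 'M[R]_(m, n) := map_mx intr v.

Definition lat_mod2 v : 'M['F_2]_(m, n) := map_mx intr v.

Definition lattice_polytope P :=
  exists s : seq 'M[int]_(m, n), P = conv_hull (map lat_real s).

Definition primitive v := forall (k : int) w, v = k *: w -> `|k|%N = 1%N.

(* The image in the lattice mod 2 of the lattice points of span C; see
   [mem_span_mod2] below. *)
Definition span_mod2 C : {vspace 'M['F_2]_(m, n)} :=
  linspan (lat_mod2 @` [set v | lat_real v \in linspan C]).

Lemma mem_span_mod2 C x : reflect
  (exists2 v, lat_real v \in linspan C & x = lat_mod2 v)
  (x \in span_mod2 C).
Proof.
set L := [set v | lat_real v \in linspan C].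
have LD u v (k : int) : L u -> L v -> L (k *: u + v).
  rewrite /L /= /lat_real => Lu Lv.
  by rewrite map_mxD map_mxZ memvD // memvZ.
have L0 : L 0 by rewrite /L /= /lat_real map_mx0 mem0v.
have [sub1 sub2] := linspanP (lat_mod2 @` L).
apply: (iffP idP) => [|[v Lv ->]]; last by apply: sub1; exists v.
pose X := [seq x <- enum {: 'M['F_2]_(m, n)} | `[< (lat_mod2 @` L) x >]].
have XP y : y \in X -> (lat_mod2 @` L) y.
  by rewrite mem_filter => /andP[/asboolP].
have : (span_mod2 C <= <<X>>)%VS.
  apply: sub2 => y Ly; apply: memv_span.
  by rewrite mem_filter mem_enum andbT; apply/asboolP.
move=> /subvP/[apply] /(@coord_span _ _ _ (in_tuple X)) ->.
have [v Lv <-] : (lat_mod2 @` L) (\sum_(i < size X)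
    coord (in_tuple X) i x *: X`_i); last by exists v.
elim/big_ind: _ => [|a b [u Lu <-] [v Lv <-]|i _].
- by exists 0 => //; rewrite /lat_mod2 map_mx0.
- exists (1 *: u + v); first exact: LD.
  by rewrite scale1r /lat_mod2 map_mxD.
- have [v Lv <-] := XP _ (mem_nth 0 (ltn_ord i)).
  set a := coord _ _ _; exists ((a : nat)%:Z *: v + 0); first exact: LD.
  by rewrite /lat_mod2 addr0 map_mxZ /= -pmulrn natr_Zp.
Qed.

Definition is_ray C (r : set 'M[R]_(m, n)) := is_face C r /\ dim_span r = 1%N.

Definition ray_generator C v :=
  exists r, [/\ is_ray C r, r (lat_real v) & primitive v].

Definition Z2_regular C :=
  exists s : seq 'M[int]_(m, n),
    [/\ uniq s, forall v, v \in s <-> ray_generator C v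
      & basis_of (span_mod2 C) (map lat_mod2 s)].

End Lattice.

Section Reflexive.
Variables (R : realType) (d : nat).

Definition pairing (m : 'rV[R]_d) (n : 'cV[R]_d) : R := (m *m n) 0 0.

Definition polar (P : set 'rV[R]_d) : set 'cV[R]_d :=
  [set n | forall m, P m -> -1 <= pairing m n].

(* The first condition forces P to have dimension d. *)
Definition reflexive_polytope (P : set 'rV[R]_d) :=
  [/\ lattice_polytope P, P^° 0 & lattice_polytope (polar P)].

Definition normal_cone (P F : set 'rV[R]_d) : set 'cV[R]_d :=
  [set n | forall m m', F m -> P m' -> pairing m n <= pairing m' n].

Definition normal_fan (P : set 'rV[R]_d) : set (set 'cV[R]_d) :=
  [set C | exists F, [/\ is_face P F, F !=set0 & C = normal_cone P F]].

Lemma finite_normal_fan P : lattice_polytope P -> finite_set (normal_fan P).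
Proof.
case=> s0; set s := map _ _ => Ps.
pose K (A : {set 'I_(size s)}) : set 'cV[R]_d :=
  [set n | forall i m', i \in A -> P m' -> pairing s`_i n <= pairing m' n].
suff sub : normal_fan P `<=` K @` [set: {set 'I_(size s)}].
  by apply: sub_finite_set sub _; apply: finite_image; exact: finite_finset.
have Psi (i : 'I_(size s)) : P s`_i.
  rewrite Ps; exists (fun k => (k == i)%:R).
  split=> [k|| ]; first exact: ler0n.
    by rewrite (bigD1 i) //= eqxx big1 ?addr0 // => k /negPf ->.
  rewrite (bigD1 i) //= eqxx scale1r big1 ?addr0 // => k /negPf ->.
  by rewrite scale0r.
move=> C [F [[u Fu] _ ->]].
exists [set i : 'I_(size s) | `[< F s`_i >]]%SET => //.
apply/seteqP; split=> n /= hn; last first.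
  by move=> i m'; rewrite finset.inE => /asboolP; apply: hn.
move=> x m' Fx Pm'; have [Px xmin] : P x /\ forall y, P y -> u x <= u y.
  by move: Fx; rewrite Fu.
have [a [a0 a1 xE]] : conv_hull s x by rewrite -Ps.
have Fs i : a i != 0 -> F s`_i.
  move=> ai0.
  have ux : \sum_k a k * (u s`_k - u x) = 0.
    under eq_bigr do rewrite mulrBr.
    rewrite sumrB -mulr_suml a1 mul1r [in X in _ - X]xE linear_sum /=.
    by under [X in _ - X]eq_bigr do rewrite linearZ /=; rewrite subrr.
  have ge0 k : true -> 0 <= a k * (u s`_k - u x).
    by move=> _; apply: mulr_ge0 => //; rewrite subr_ge0 xmin.
  have /eqP := @psumr_eq0P _ _ xpredT _ ge0 ux i isT.
  rewrite mulf_eq0 (negPf ai0) /=.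
  rewrite subr_eq0 => /eqP ui; rewrite Fu; split=> // y /xmin.
  by rewrite ui.
rewrite /pairing xE mulmx_suml summxE.
rewrite -[leRHS]mul1r -a1 mulr_suml; apply: ler_sum => i _.
rewrite -scalemxAl mxE; have [->|ai0] := eqVneq (a i) 0.
  by rewrite !mul0r.
apply: ler_wpM2l => //; apply: hn => //.
by rewrite finset.inE; apply/asboolP/Fs.
Qed.

End Reflexive.

Section GroupAlgebra.
Variables (K : fieldType) (gT : finGroupType).

Definition galg : Type := {ffun gT -> K^o}.

HB.instance Definition _ := Vector.on galg.

Implicit Types x y z : galg.

Definition galg_one : galg := [ffun g => (g == 1%g)%:R].

Definition galg_mul x y : galg := [ffun g => \sum_h x h * y (h^-1 * g)%g].

Fact galg_mulA : associative galg_mul.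
Proof.
move=> x y z; apply/ffunP => g; rewrite !ffunE.
under eq_bigr => h _ do rewrite ffunE mulr_sumr.
under [RHS]eq_bigr => h _ do rewrite ffunE mulr_suml.
rewrite [RHS]exchange_big; apply: eq_bigr => h _ /=.
rewrite [RHS](reindex (mulg h)); last first.
  by exists (mulg h^-1) => k _; rewrite ?mulKg ?mulKVg.
by apply: eq_bigr => k _; rewrite mulrA mulKg invMg mulgA.
Qed.

Fact galg_mul1 : left_id galg_one galg_mul.
Proof.
move=> x; apply/ffunP => g; rewrite ffunE (bigD1 1%g) //= ffunE eqxx mul1r.
rewrite invg1 mul1g big1 ?addr0 // => h /negPf h1.
by rewrite ffunE h1 mul0r.
Qed.

Fact galg_mulr1 : right_id galg_one galg_mul.
Proof.
move=> x; apply/ffunP => g; rewrite ffunE (bigD1 g) //= ffunE mulVg eqxx mulr1.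
rewrite big1 ?addr0 // => h hg.
by rewrite ffunE -eq_invg_mul invgK (negPf hg) mulr0.
Qed.

Fact galg_mulDl : left_distributive galg_mul +%R.
Proof.
move=> x y z; apply/ffunP => g; rewrite !ffunE -big_split.
by apply: eq_bigr => h _; rewrite ffunE mulrDl.
Qed.

Fact galg_mulDr : right_distributive galg_mul +%R.
Proof.
move=> x y z; apply/ffunP => g; rewrite !ffunE -big_split.
by apply: eq_bigr => h _; rewrite ffunE mulrDr.
Qed.

Fact galg_one_neq0 : galg_one != 0.
Proof.
by apply/eqP => /ffunP/(_ 1%g)/eqP; rewrite !ffunE eqxx oner_eq0.
Qed.

HB.instance Definition _ := GRing.Zmodule_isNzRing.Build galg
  galg_mulA galg_mul1 galg_mulr1 galg_mulDl galg_mulDr galg_one_neq0.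

Fact galg_scaleAl (a : K) x y : a *: (x * y) = a *: x * y.
Proof.
apply/ffunP => g; rewrite !ffunE scaler_sumr.
by apply: eq_bigr => h _; rewrite ffunE -scalerAl.
Qed.

HB.instance Definition _ :=
  GRing.Lmodule_isLalgebra.Build K galg galg_scaleAl.

Fact galg_scaleAr (a : K) x y : a *: (x * y) = x * (a *: y).
Proof.
apply/ffunP => g; rewrite !ffunE scaler_sumr.
by apply: eq_bigr => h _; rewrite ffunE -scalerAr.
Qed.

HB.instance Definition _ := GRing.Lalgebra_isAlgebra.Build K galg galg_scaleAr.
HB.instance Definition _ := Algebra_isFalgebra.Build K galg.

Definition augmentation x : K^o := \sum_g x g.

Fact augmentation_is_linear : linear augmentation.
Proof.
move=> a x y; rewrite /augmentation scaler_sumr -big_split.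
by apply: eq_bigr => g _; rewrite !ffunE.
Qed.
HB.instance Definition _ :=
  GRing.isLinear.Build K galg K^o _ augmentation augmentation_is_linear.

Definition aug_ideal : {vspace galg} := lker (linfun augmentation).

(* [expv] gives (I ^+ 0)%VS = 1%VS, the scalars, hence the separate case. *)
Definition aug_ideal_pow (k : int) : {vspace galg} :=
  if k <= 0 then fullv else (aug_ideal ^+ `|k|)%VS.

End GroupAlgebra.

Definition galg_push (K : fieldType) (gT hT : finGroupType) (f : gT -> hT)
  (x : galg K gT) : galg K hT := [ffun h => \sum_(g | f g == h) x g].

(* The homology spectral sequence of a filtered chain complex with total space
   V, differential bd and filtration F p n = F_p C_n, increasing in p. *)
Section SpectralSequence.
Variables (K : fieldType) (V : vectType K) (bd : 'End(V)).
Variable F : int -> int -> {vspace V}.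

Section Subquotient.
Variables Z B : {vspace V}.

Definition subquot_den : {vspace subvs_of Z} :=
  (linfun (vsval : subvs_of Z -> V) @^-1: B)%VS.

Definition subquot : zmodType := {ideal_quot (pred_of_vspace subquot_den)}.

Definition subquot_pi (x : subvs_of Z) : subquot := (\pi_subquot x)%qT.

End Subquotient.

(* The map induced by bd on subquotients; well defined when bd maps Z to Z'
   and B to B', see [subquot_mapE]. *)
Definition subquot_map (Z B Z' B' : {vspace V}) (x : subquot Z B) :
    subquot Z' B' :=
  subquot_pi B' (vsproj Z' (bd (vsval (repr x)))).

Lemma subquot_mapE (Z B Z' B' : {vspace V}) :
    (bd @: Z <= Z')%VS -> (bd @: (Z :&: B) <= B')%VS ->
  forall (x : subvs_of Z) (y : subvs_of Z'), vsval y = bd (vsval x) ->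
    subquot_map Z' B' (subquot_pi B x) = subquot_pi B' y.
Proof.
move=> /subvP dZ /subvP dB x y yx; apply/eqP.
rewrite /subquot_map /subquot_pi -Quotient.idealrBE.
set x' := repr _.
have : x' - x \in subquot_den Z B.
  by rewrite Quotient.idealrBE reprK.
rewrite /subquot_den -!memv_preim !lfunE /= vsprojK; last first.
  by apply/dZ/memv_img/subvsP.
rewrite yx => h; apply: dB; rewrite -[_ - _](linearB bd); apply: memv_img.
by rewrite memv_cap h memvB ?subvsP.
Qed.

(* Cycles and boundaries are indexed by r, the filtration degree p and the
   total degree n. *)
Definition ss_Z (r p n : int) : {vspace V} :=
  (F p n :&: bd @^-1: F (p - r) (n - 1))%VS.

Definition ss_B (r p n : int) : {vspace V} :=
  (ss_Z (r - 1) (p - 1) n + bd @: ss_Z (r - 1) (p + r - 1) (n + 1))%VS.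

(* r >= 1 is intended here and below. *)
Definition ss_E (r p q : int) : zmodType :=
  subquot (ss_Z r p (p + q)) (ss_B r p (p + q)).

(* The target of d^r in bidegree (p, q) has (p', q') = (p - r, q + r - 1);
   p' and q' are left free so that it can be typed at any expressions equal to
   these. *)
Definition ss_d (r p q p' q' : int) : ss_E r p q -> ss_E r p' q' :=
  @subquot_map _ _ _ _.

End SpectralSequence.

Section ToricComplex.
Variables (R : realType) (d : nat) (Sigma : set (set 'cV[R]_d)).

(* [fset_set] returns the empty set on an infinite Sigma; see
   [finite_normal_fan]. *)
Definition cone : finType := (fset_set Sigma : finType).

Implicit Types sigma tau : cone.

Definition cone_set sigma : set 'cV[R]_d := val sigma.

Definition cone_dim sigma : nat := dim_span (cone_set sigma).

Definition N_sub sigma : {set 'cV['F_2]_d} :=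
  [set x in span_mod2 (cone_set sigma)]%SET.

Lemma N_sub_group_set sigma : group_set (N_sub sigma).
Proof.
apply/group_setP; split=> [|x y]; rewrite !finset.inE ?mem0v //.
exact: memvD.
Qed.

(* N(sigma), written multiplicatively. *)
Definition N_quot sigma : finGroupType := coset_of (N_sub sigma).

(* The quotient map for sigma a face of tau, where N_sub sigma is contained in
   N_sub tau and the choice of representative does not matter. *)
Definition N_proj sigma tau (t : coset_of (N_sub sigma)) :
    coset_of (N_sub tau) :=
  coset (N_sub tau) (fingroup.repr t).

Definition cell : finType := {sigma : cone & N_quot sigma}.

(* The sum of the C_j over all j, that is, chains on all cells. *)
Definition chain : vectType 'F_2 := {ffun cell -> ('F_2)^o}.

Definition chain_at sigma (c : chain) : galg 'F_2 (N_quot sigma) :=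
  [ffun t => c (Tagged N_quot t)].

Fact chain_at_is_linear sigma : linear (chain_at sigma).
Proof. by move=> a c c'; apply/ffunP => t; rewrite !ffunE. Qed.
HB.instance Definition _ sigma :=
  GRing.isLinear.Build 'F_2 chain (galg 'F_2 (N_quot sigma)) _
    (chain_at sigma) (chain_at_is_linear sigma).

Definition is_facet sigma tau :=
  is_face (cone_set tau) (cone_set sigma) /\ cone_dim tau = (cone_dim sigma).+1.

Definition boundary_fun (c : chain) : chain :=
  [ffun x : cell => \sum_(sigma | `[< is_facet sigma (tag x) >])
     galg_push (N_proj (tag x)) (chain_at sigma c) (tagged x)].

Fact boundary_is_linear : linear boundary_fun.
Proof.
move=> a c c'; apply/ffunP => x; rewrite !ffunE scaler_sumr -big_split.
apply: eq_bigr => sigma _; rewrite !ffunE scaler_sumr -big_split.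
by apply: eq_bigr => t _; rewrite linearP !ffunE.
Qed.
HB.instance Definition _ :=
  GRing.isLinear.Build 'F_2 chain chain _ boundary_fun boundary_is_linear.

Definition boundary : 'End(chain) := linfun boundary_fun.

Definition chain_filt (p j : int) : {vspace chain} :=
  (\bigcap_(sigma : cone) linfun (chain_at sigma) @^-1:
     (if (cone_dim sigma)%:Z == d%:Z - j
      then aug_ideal_pow 'F_2 (N_quot sigma) (d%:Z - p) else 0))%VS.

Lemma mem_chain_filt p j (c : chain) : reflect
  (forall sigma, if (cone_dim sigma)%:Z == d%:Z - j
     then chain_at sigma c \in aug_ideal_pow 'F_2 (N_quot sigma) (d%:Z - p)
     else chain_at sigma c == 0)
  (c \in chain_filt p j).
Proof.
apply: (iffP idP) => [cF sigma|cF].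
  have : (chain_filt p j <= linfun (chain_at sigma) @^-1: _)%VS :=
    bigcapv_inf sigma isT (subvv _).
  by move=> /subvP/(_ c cF); rewrite -memv_preim lfunE; case: ifP;
    rewrite ?memv0.
rewrite memvE; apply/subv_bigcapP => sigma _; rewrite -memvE -memv_preim lfunE.
by have := cF sigma; case: ifP => // _; rewrite memv0.
Qed.

Definition Etilde (r p q : int) : zmodType := ss_E boundary chain_filt r p q.

Definition dtilde (r p q : int) :
    Etilde r p q -> Etilde r (p - r) (q + r - 1) :=
  @ss_d _ _ boundary chain_filt r p q _ _.

Definition Ebar (r p q : int) : zmodType := Etilde r (d%:Z - q) (p + q - d%:Z).

Definition dbar (r p q : int) : Ebar r p q -> Ebar r (p - 1) (q + r) :=
  @ss_d _ _ boundary chain_filt r _ _ _ _.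

Lemma dbarE (r p q : int) (x : Ebar r p q) :
  existT (fun pq : int * int => Etilde r pq.1 pq.2 : Type)
    (d%:Z - (q + r), p - 1 + (q + r) - d%:Z) (dbar x) =
  existT (fun pq : int * int => Etilde r pq.1 pq.2 : Type)
    (d%:Z - q - r, p + q - d%:Z + r - 1) (dtilde x).
Proof.
have transp (a b : int * int) : a = b ->
    existT (fun pq : int * int => Etilde r pq.1 pq.2 : Type)
      a (ss_d a.1 a.2 x) = existT _ b (ss_d b.1 b.2 x) by move=> ->.
by apply: transp; congr (_, _); lia.
Qed.

End ToricComplex.

(* Main.v *)
Require Import Defs.
From HB Require Import structures.
From mathcomp Require Import all_boot all_order all_algebra all_fingroup.
From mathcomp Require Import falgebra generic_quotient ring_quotient finmap.
From mathcomp Require Import boolp classical_sets cardinality reals.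
From mathcomp Require Import topology normedtype zify ring lra.

(** The spectral sequence of a filtered complex degenerates at E^1 as soon as
    the boundary is strict: a boundary of filtration level p' is the boundary of
    a chain of level p'.

    For a cone sigma <> 0, dual to a proper face f of Delta, regularity makes f a
    simplex whose vertices are independent mod 2, and reflexivity (f has lattice
    height 1) identifies N(sigma) with the dual of the mod 2 vectors of
    coefficient sum 0, i.e. with Z_2^V / (1,...,1), V the vertex set of f. Fix an
    order on the vertices of Delta. The classes of the threshold vectors
    (v_j >= v_i)_j form a basis of N(sigma), and every projection N(sigma) ->
    N(tau) sends each of them to 0 or to a threshold vector. Hence the monomials
    in the elements (g - 1) with g a threshold vector grade the group algebras
    compatibly with the boundary, and discarding the monomials of degree < k
    gives strictness.

    For sigma = 0 the boundary is the family of projections onto N / n_tau, tau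
    a ray with n_tau its only nonzero mod 2 vector. Choose a basis of N/2N
    beginning with a maximal independent set b_1, ..., b_a of the n_tau. If all
    the projections of c lie in I^k, each monomial of c of degree < k involves
    b_1, ..., b_a, so the sum of these monomials is invariant under every n_tau
    and its projections vanish.

    The square of the boundary is 0 because an interval of length 2 in the fan
    has two intermediate cones. *)

Set Implicit Arguments.
Unset Strict Implicit.
Unset Printing Implicit Defensive.

Import Order.TTheory GRing.Theory Num.Theory.
Import numFieldNormedType.Exports.
Local Open Scope ring_scope.

(** * Degeneration of the spectral sequence of a filtered complex *)

(** For a representative [v] of the class, strictness gives [y] in level [p - r] with [bd y = bd v].
    As r >= 1, [y] also lies in level [p - 1 = p' + r - 1], so [bd v] is one of the boundaries
    divided out in the target. *)
Lemma ss_d_eq0 (K : fieldType) (V : vectType K) (bd : 'End(V))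
    (F : int -> int -> {vspace V}) (r p q p' q' : int) :
    (forall x, bd (bd x) = 0) ->
    (forall a b n, a <= b -> (F a n <= F b n)%VS) ->
    (forall x, x \in F p (p + q) -> bd x \in F (p - r) (p + q - 1) ->
       exists2 y, y \in F (p - r) (p + q) & bd y = bd x) ->
    1 <= r -> p' = p - r -> q' = q + r - 1 ->
  forall x : ss_E bd F r p q, ss_d p' q' x = 0.
Proof.
move=> bd0 Fmono strict r1 pE qE x; rewrite /ss_d /subquot_map.
set v := vsval _.
have pq' : p' + q' = p + q - 1 by lia.
have /memv_capP[vF] : v \in ss_Z bd F r p (p + q) := subvsP _.
rewrite -memv_preim => bvF.
have [y yF ybd] := strict _ vF bvF.
rewrite /subquot_pi; transitivity ((\pi_(subquot (ss_Z bd F r p' (p' + q'))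
  (ss_B bd F r p' (p' + q'))) 0)%qT); last exact: pi_zeror.
apply/eqP.
rewrite -Quotient.idealrBE subr0 /subquot_den -!memv_preim lfunE /= vsprojK.
  rewrite -ybd /ss_B; apply: (subvP (addvSr _ _)); apply: memv_img.
  rewrite memv_cap -memv_preim ybd pq' subrK.
  apply/andP; split; first by apply: (subvP (Fmono _ _ _ _)) yF; lia.
  by have -> : p' + r - 1 - (r - 1) = p - r by lia.
by rewrite memv_cap -memv_preim bd0 mem0v andbT pq' pE.
Qed.

(** * Group algebras of elementary abelian 2-groups *)

Section GroupAlgebraTheory.
Variables (K : fieldType) (gT : finGroupType).
Implicit Types (x y : galg K gT) (g h : gT) (I : finType).

Definition galg_delta g : galg K gT := [ffun h => (h == g)%:R].

Lemma galg_mulE x y g : (x * y) g = \sum_h x h * y (h^-1 * g)%g.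
Proof. exact: ffunE. Qed.

Lemma galg_addE x y g : (x + y) g = x g + y g. Proof. exact: ffunE. Qed.
Lemma galg_scaleE a x g : (a *: x) g = a * x g. Proof. exact: ffunE. Qed.
Lemma galg_0E g : (0 : galg K gT) g = 0. Proof. exact: ffunE. Qed.

Lemma galg_sumE (I : Type) (r : seq I) (P : pred I) (F : I -> galg K gT) g :
  (\sum_(i <- r | P i) F i) g = \sum_(i <- r | P i) F i g.
Proof. by elim/big_rec2: _ => [|i y1 y2 _ <-]; rewrite ?galg_0E ?galg_addE. Qed.

Lemma galg_delta1 : galg_delta 1%g = 1.
Proof. by apply/ffunP => g; rewrite !ffunE. Qed.

Lemma galg_deltaME g x h : (galg_delta g * x) h = x (g^-1 * h)%g.
Proof.
rewrite galg_mulE (bigD1 g) //= ffunE eqxx mul1r big1 ?addr0 // => k /negPf kg.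
by rewrite ffunE kg mul0r.
Qed.

Lemma galg_deltaM g h : galg_delta (g * h)%g = galg_delta g * galg_delta h.
Proof.
apply/ffunP => k; rewrite galg_deltaME !ffunE.
by congr (_%:R); rewrite -[in RHS](inj_eq (mulgI g)) mulKVg.
Qed.

Lemma galg_sum_delta x : x = \sum_g x g *: galg_delta g.
Proof.
apply/ffunP => h; rewrite galg_sumE (bigD1 h) //= galg_scaleE ffunE eqxx mulr1.
by rewrite big1 ?addr0 // => g /negPf gh; rewrite galg_scaleE ffunE eq_sym gh mulr0.
Qed.

Lemma galg_mulC : (forall g h, g * h = h * g)%g -> forall x y, x * y = y * x.
Proof.
move=> gC x y; rewrite (galg_sum_delta x) (galg_sum_delta y).
rewrite mulr_suml mulr_sumr; apply: eq_bigr => g _.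
rewrite mulr_sumr mulr_suml; apply: eq_bigr => h _.
rewrite -!scalerAl -!scalerAr -!galg_deltaM gC scalerA mulrC -scalerA.
by rewrite !scalerA mulrC.
Qed.

Lemma mem_aug_ideal x : (x \in aug_ideal K gT) = (\sum_g x g == 0).
Proof. by rewrite memv_ker lfunE. Qed.

Lemma aug_ideal_pow_anti k l : k <= l ->
  (aug_ideal_pow K gT l <= aug_ideal_pow K gT k)%VS.
Proof.
(* Exponents start at 1: the power 0 in the sense of [expv] is the line of scalars, which need not
   contain the augmentation ideal I. *)
have step n : (aug_ideal K gT ^+ n.+2 <= aug_ideal K gT ^+ n.+1)%VS.
  rewrite (expvSl _ n.+1) (expvSl _ n) prodvA; apply: prodvSl.
  apply/prodvP => x y; rewrite !mem_aug_ideal => /eqP x0 _.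
  under eq_bigr do rewrite galg_mulE; rewrite exchange_big /=.
  under eq_bigr => h _.
    rewrite -mulr_sumr (reindex_inj (mulgI h)) /=.
    under eq_bigr do rewrite mulKg; over.
  by rewrite -mulr_suml x0 mul0r.
rewrite /aug_ideal_pow; case: (lerP k 0) => [_ _|k0 kl]; first exact: subvf.
have -> : l <= 0 = false by lia.
have [i ki] : exists i, `|k|%N = i.+1 by exists `|k|.-1; lia.
have [j ->] : exists j, `|l|%N = (j + `|k|)%N by exists (`|l| - `|k|)%N; lia.
rewrite ki; elim: j => [|j IH]; first exact: subvv.
by rewrite addSn addnS; apply: subv_trans (step _) _; rewrite -addnS.
Qed.

(** When the [u i] are F_2-coordinates on [gT], this is the coefficient in [x] of the monomial
    indexed by [T]; see [coords_expand]. *)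
Definition galg_moment I (u : I -> gT -> K) (T : {set I}) x : K^o :=
  \sum_g x g * \prod_(i in T) u i g.

Fact galg_moment_is_linear I u (T : {set I}) : linear (galg_moment u T).
Proof.
move=> a x y; rewrite /galg_moment scaler_sumr -big_split.
by apply: eq_bigr => g _; rewrite galg_addE galg_scaleE mulrDl -mulrA.
Qed.
HB.instance Definition _ I u (T : {set I}) :=
  GRing.isLinear.Build K (galg K gT) K^o _ (galg_moment u T)
    (galg_moment_is_linear u T).

Lemma galg_moment_delta I u (T : {set I}) g :
  galg_moment u T (galg_delta g) = \prod_(i in T) u i g.
Proof.
rewrite /galg_moment (bigD1 g) //= ffunE eqxx mul1r [X in _ + X]big1 ?addr0 // => h /negPf hg.
by rewrite ffunE hg mul0r.
Qed.

(** A product of fewer than k additive functions is a polynomial of degree < k, and these annihilate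
    I^k. The induction on k splits off a last factor [y] in I and expands the product of the
    [u i g + u i h] over the subsets [J] of [T]. *)
Lemma galg_moment_aug_pow I (u : I -> gT -> K) (T : {set I}) (k : nat) x :
    (forall i g h, u i (g * h)%g = u i g + u i h) ->
  x \in aug_ideal_pow K gT k%:Z -> (#|T| < k)%N -> galg_moment u T x = 0.
Proof.
move=> uM; case: k => // k; rewrite /aug_ideal_pow /= => xk.
elim: k => [|k IH] in T x xk *; rewrite ltnS.
  rewrite leqn0 cards_eq0 => /eqP ->.
  move: xk; rewrite expv1 mem_aug_ideal => /eqP x0.
  by rewrite /galg_moment; under eq_bigr do rewrite big_set0 mulr1.
move=> Tk; move: xk; rewrite expvSr.
suff : (aug_ideal K gT ^+ k.+1 * aug_ideal K gT <=
        lker (linfun (galg_moment u T)))%VS.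
  by move=> /subvP/[apply]; rewrite memv_ker lfunE => /eqP.
apply/prodvP => {}x y xI; rewrite mem_aug_ideal memv_ker lfunE => /eqP y0 /=.
have -> : galg_moment u T (x * y) =
    \sum_g \sum_h x g * y h * \prod_(i in T) (u i g + u i h).
  rewrite /galg_moment; under eq_bigr do rewrite galg_mulE mulr_suml.
  rewrite exchange_big; apply: eq_bigr => g _ /=.
  rewrite (reindex_inj (mulgI g)) /=; apply: eq_bigr => h _.
  by rewrite mulKg; congr (_ * _); apply: eq_bigr => i _; rewrite uM.
(* With [F] equal to 0 and [G] equal to 1 outside [T], the product runs over the whole index type,
   and a subset [J] not inside [T] contributes 0. *)
pose F g i := if i \in T then u i g else 0.
pose G h i := if i \in T then u i h else 1.
have -> : \sum_g \sum_h x g * y h * \prod_(i in T) (u i g + u i h) =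
    \sum_(J in {set I}) (\sum_g x g * \prod_(i in J) F g i) *
                     (\sum_h y h * \prod_(i in ~: J) G h i).
  under [RHS]eq_bigr => J _ do rewrite mulr_suml.
  rewrite [RHS]exchange_big; apply: eq_bigr => g _ /=.
  under [RHS]eq_bigr => J _ do rewrite mulr_sumr.
  rewrite [RHS]exchange_big; apply: eq_bigr => h _ /=.
  have -> : \prod_(i in T) (u i g + u i h) = \prod_i (F g i + G h i).
    rewrite big_mkcond; apply: eq_bigr => i _; rewrite /F /G.
    by case: ifP => //; rewrite add0r.
  rewrite (bigA_distr 1 +%R) mulr_sumr; apply: eq_bigr => J _.
  rewrite mulrACA; congr (_ * _).
  rewrite (big_mkcond (fun i => i \in J)) (big_mkcond (fun i => i \in ~: J)).
  rewrite -big_split; apply: eq_bigr => i _ /=.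
  by rewrite !inE; case: ifP; rewrite ?mulr1 ?mul1r.
apply/eqP; apply: big1 => J _.
have [/fintype.subsetP JT|/fintype.subsetPn[i iJ iT]] := boolP (J \subset T); last first.
  rewrite big1 ?mul0r // => g _.
  by rewrite (bigD1 i) //= /F (negPf iT) mul0r mulr0.
have JE g : \prod_(i in J) F g i = \prod_(i in J) u i g.
  by apply: eq_bigr => i /JT; rewrite /F => ->.
under eq_bigr do rewrite JE.
(* A small [J] is settled by induction on the factor [x]; the only other possibility is [J = T],
   which leaves the augmentation of [y] as second factor. *)
have [Jk|kJ] := ltnP #|J| k.+1.
  by move: (IH J x xI Jk); rewrite /galg_moment => ->; rewrite mul0r.
have -> : J = T.
  by apply/eqP; rewrite eqEcard; apply/andP; split; [exact/fintype.subsetP|lia].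
rewrite [X in _ * X](_ : _ = 0) ?mulr0 // -[RHS]y0; apply: eq_bigr => h _.
by rewrite big1 ?mulr1 // => i; rewrite inE /G => /negPf ->.
Qed.

End GroupAlgebraTheory.

Section GroupAlgebraPush.
Variables (K : fieldType) (gT hT : finGroupType) (f : gT -> hT).

Fact galg_push_is_linear : linear (@galg_push K gT hT f).
Proof.
move=> a x y; apply/ffunP => h; rewrite galg_addE galg_scaleE !ffunE.
rewrite mulr_sumr -big_split.
by apply: eq_bigr => g _; rewrite galg_addE galg_scaleE.
Qed.
HB.instance Definition _ :=
  GRing.isLinear.Build K (galg K gT) (galg K hT) _ (galg_push f)
    galg_push_is_linear.

Lemma galg_push_delta g : galg_push f (galg_delta K g) = galg_delta K (f g).
Proof.
apply/ffunP => h; rewrite !ffunE; under eq_bigr do rewrite ffunE.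
have [->|hg] := eqVneq h (f g).
  rewrite (bigD1 g) //= eqxx [X in _ + X]big1 ?addr0 // => k /andP[_ /negPf kg].
  by rewrite kg.
rewrite big1 // => k /eqP fk; case: eqP => // kg.
by rewrite -fk kg eqxx in hg.
Qed.

Hypothesis fM : {morph f : g h / (g * h)%g}.

Lemma galg_pushM : {morph @galg_push K gT hT f : x y / x * y}.
Proof.
move=> x y; rewrite (galg_sum_delta x) (galg_sum_delta y).
rewrite mulr_suml !linear_sum mulr_suml; apply: eq_bigr => g _ /=.
rewrite mulr_sumr !linear_sum mulr_sumr; apply: eq_bigr => h _ /=.
rewrite -scalerAl -scalerAr -galg_deltaM !linearZ /= !galg_push_delta fM.
by rewrite -scalerAl -scalerAr -galg_deltaM.
Qed.

Lemma galg_push1 : galg_push f (1 : galg K gT) = 1.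
Proof.
rewrite -!galg_delta1 galg_push_delta; congr galg_delta.
by apply: (mulgI (f 1%g)); rewrite -fM !mulg1.
Qed.

Lemma galg_moment_push (I : finType) (u : I -> hT -> K) (T : {set I}) x :
  galg_moment u T (galg_push f x) = galg_moment (fun i => u i \o f) T x.
Proof.
rewrite (galg_sum_delta x) !linear_sum; apply: eq_bigr => g _ /=.
by rewrite !linearZ /= galg_push_delta !galg_moment_delta.
Qed.

End GroupAlgebraPush.

Section AugmentationProducts.
Variables (K : fieldType) (gT : finGroupType).
Implicit Types (g : gT) (s : seq gT).

Definition aug_prod s : galg K gT := \prod_(g <- s) (galg_delta K g - 1).

Lemma mem_aug_prod s : aug_prod s \in aug_ideal_pow K gT (size s)%:Z.
Proof.
suff: aug_prod s \in (aug_ideal K gT ^+ size s)%VS.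
  by rewrite /aug_ideal_pow; case: (size s) => [|n] // _; rewrite memvf.
rewrite /aug_prod; elim: s => [|g s IH]; first by rewrite big_nil expv0 memv_line.
rewrite big_cons expvSl memv_mul // mem_aug_ideal.
under eq_bigr do rewrite !ffunE.
rewrite sumrB (bigD1 g) //= eqxx big1 => [|h /negPf -> //].
by rewrite (bigD1 1%g) //= eqxx big1 ?addr0 ?subrr // => h /negPf ->.
Qed.

Lemma galg_push_aug_prod (hT : finGroupType) (f : gT -> hT) s :
  {morph f : g h / (g * h)%g} ->
  galg_push f (aug_prod s) = \prod_(g <- map f s) (galg_delta K g - 1).
Proof.
move=> fM; rewrite /aug_prod big_map.
elim: s => [|g s IH]; first by rewrite !big_nil galg_push1.
by rewrite !big_cons galg_pushM // IH linearB /= galg_push1 // galg_push_delta.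
Qed.

End AugmentationProducts.

(** * Coordinates and monomials in group algebras *)

Lemma F2P (a : 'F_2) : a = 0 \/ a = 1.
Proof. by case: a => [[|[|//]] ?]; [left|right]; apply: val_inj. Qed.

(* These axioms force gT to be an elementary abelian 2-group with basis cbas. *)
Record coords (gT : finGroupType) := Coords {
  cidx : finType;
  cfun : cidx -> gT -> 'F_2;
  cbas : cidx -> gT;
  cfunM : forall i g h, cfun i (g * h)%g = cfun i g + cfun i h;
  cfun_eq0 : forall g, (forall i, cfun i g = 0) -> g = 1%g;
  cfun_bas : forall i j, cfun i (cbas j) = (i == j)%:R }.

Section Coordinates.
Variables (gT : finGroupType) (k : coords gT).
Implicit Types (T : {set cidx k}) (x : galg 'F_2 gT).

Let moment T x := galg_moment (@cfun gT k) T x.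

Definition cbas_seq T := [seq cbas i | i <- index_enum (cidx k) & i \in T].

Lemma size_cbas_seq T : size (cbas_seq T) = #|T|.
Proof. by rewrite size_map -sum1_size big_filter sum1_card. Qed.

Definition cmonom T : galg 'F_2 gT := aug_prod 'F_2 (cbas_seq T).

Lemma cfun1 i : @cfun gT k i 1%g = 0.
Proof.
by apply: (addrI (cfun i 1%g)); rewrite -cfunM mulg1 addr0.
Qed.

Lemma cfun_expand g : (\prod_(i : cidx k) cbas i ^+ (cfun i g : 'F_2))%g = g.
Proof.
set h := \big[_/_]_i _.
have uh (j : cidx k) : cfun j h = cfun j g.
  have hE : cfun j h = \sum_i cfun j (@cbas gT k i ^+ (cfun i g : 'F_2))%g.
    by rewrite /h (@big_morph _ _ (@cfun gT k j) 0 +%R 1%g (@mulg gT) (cfunM j) (cfun1 j)).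
  rewrite hE (bigD1 j) //= big1 ?addr0 => [|i ij].
    by case: (F2P (cfun j g)) => ->; rewrite ?expg0 ?cfun1 // expg1 cfun_bas eqxx.
  case: (F2P (cfun i g)) => ->; rewrite ?expg0 ?cfun1 // expg1 cfun_bas.
  by rewrite eq_sym (negPf ij).
have : (g^-1 * h)%g = 1%g.
  apply: (@cfun_eq0 gT k) => i; apply: (addrI (cfun i g)).
  by rewrite -cfunM mulKVg uh addr0.
by move/eqP; rewrite -eq_mulVg1 => /eqP.
Qed.

(** Write g as a product of basis elements b and each b as (b - 1) + 1. Multiplying out, the
    monomial of [T] receives the product of the coordinates of g in [T], which is the moment of the
    delta at g. *)
Lemma coords_expand x : x = \sum_T moment T x *: cmonom T.
Proof.
rewrite {1}(galg_sum_delta x).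
transitivity (\sum_g \sum_T (x g * moment T (galg_delta 'F_2 g)) *: cmonom T).
  apply: eq_bigr => g _.
  under eq_bigr do rewrite -scalerA.
  rewrite -scaler_sumr; congr (_ *: _).
  transitivity (\prod_(i : cidx k) ((cfun i g *: (galg_delta 'F_2 (cbas i) - 1)) + 1
                         : galg 'F_2 gT)).
    rewrite -{1}(cfun_expand g).
    rewrite (big_morph (@galg_delta 'F_2 gT) (@galg_deltaM 'F_2 gT) (galg_delta1 _ _)).
    apply: eq_bigr => i _; case: (F2P (cfun i g)) => ->.
      by rewrite expg0 scale0r add0r galg_delta1.
    by rewrite expg1 scale1r subrK.
  rewrite (bigA_distr 1 +%R); apply: eq_bigr => T _.
  rewrite /moment galg_moment_delta /cmonom /aug_prod big_map big_filter.
  by rewrite -GRing.scaler_prod [RHS]big_mkcond.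
rewrite exchange_big; apply: eq_bigr => T _ /=.
rewrite -scaler_suml; congr (_ *: _).
rewrite [in RHS](galg_sum_delta x) /moment linear_sum.
by apply: eq_bigr => g _; rewrite linearZ.
Qed.

Lemma coords_eq0 x : (forall T, moment T x = 0) -> x = 0.
Proof.
by move=> x0; rewrite (coords_expand x) big1 // => T _; rewrite x0 scale0r.
Qed.

(** Repetitions in [s] are allowed, since a projection may identify basis elements. Multiplying by
    [cbas j] shifts coordinate j alone, by 1, so a factor [cbas j - 1] turns the moment at [T] into
    the moment at [T] without j, or into 0 if j is not in [T]. *)
Lemma moment_aug_prod_small (s : seq gT) T :
    (forall g, g \in s -> g = 1%g \/ exists i, g = @cbas gT k i) ->
  (size s < #|T|)%N -> moment T (aug_prod 'F_2 s) = 0.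
Proof.
elim/last_ind: s T => [|s g IH] T sb.
  rewrite /aug_prod big_nil -galg_delta1 /moment galg_moment_delta.
  by case/card_gt0P => i iT; rewrite (bigD1 i) //= cfun1 mul0r.
rewrite size_rcons => sT; rewrite /aug_prod -cats1 big_cat big_seq1 /= -/(aug_prod _ s).
set z := aug_prod _ s.
have sb' h : h \in s -> h = 1%g \/ exists i, h = @cbas gT k i.
  by move=> hs; apply: sb; rewrite mem_rcons inE hs orbT.
have gs : g \in rcons s g by rewrite mem_rcons mem_head.
have [->|[j ->]] := sb g gs.
  by rewrite galg_delta1 subrr mulr0 /moment linear0.
rewrite mulrBr mulr1 /moment linearB /= [X in _ - X]IH ?subr0 //; last lia.
have -> : galg_moment (@cfun gT k) T (z * galg_delta 'F_2 (cbas j)) =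
    \sum_g z g * \prod_(i in T) (cfun i g + (i == j)%:R).
  rewrite [in LHS](galg_sum_delta z) mulr_suml linear_sum; apply: eq_bigr => h _.
  rewrite -scalerAl -galg_deltaM linearZ /= galg_moment_delta.
  congr (_ * _); apply: eq_bigr => i _.
  by rewrite cfunM cfun_bas.
have [jT|jT] := boolP (j \in T); last first.
  under eq_bigr => h _.
    under eq_bigr => i iT.
      have -> : (i == j) = false by apply/negP => /eqP ij; rewrite -ij iT in jT.
      rewrite addr0; over.
    over.
  by apply: IH => //; lia.
have -> : \sum_h z h * \prod_(i in T) (cfun i h + (i == j)%:R) =
    moment T z + moment (T :\ j) z.
  rewrite /moment /galg_moment -big_split; apply: eq_bigr => h _ /=.
  rewrite -mulrDr; congr (_ * _).
  rewrite (bigD1 j) //= eqxx mulrDl mul1r [in X in _ = X + _](bigD1 j) //=.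
  have E (F G : cidx k -> 'F_2) : (forall i, i != j -> F i = G i) ->
      \prod_(i in T | i != j) F i = \prod_(i in T | i != j) G i.
    by move=> FG; apply: eq_bigr => i /andP[_ /FG].
  rewrite (E _ (fun i => cfun i h)) => [|i /negPf ->]; last by rewrite addr0.
  congr (_ + _); apply: eq_bigl => i.
  by rewrite !inE andbC.
by rewrite !IH ?addr0 //; have := cardsD1 j T; rewrite jT; lia.
Qed.

Definition ctrunc n x := \sum_(T : {set cidx k} | (n <= #|T|)%N) moment T x *: cmonom T.
Definition clow n x := \sum_(T : {set cidx k} | (#|T| < n)%N) moment T x *: cmonom T.

Lemma ctrunc_clow n x : x = ctrunc n x + clow n x.
Proof.
rewrite [LHS]coords_expand (bigID (fun T => n <= #|T|)%N) /=; congr (_ + _).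
by apply: eq_bigl => T; rewrite ltnNge.
Qed.

Lemma mem_ctrunc n x : ctrunc n x \in aug_ideal_pow 'F_2 gT n%:Z.
Proof.
apply: memv_suml => T nT; apply: memvZ.
have := mem_aug_prod 'F_2 (cbas_seq T).
by apply: subvP; apply: aug_ideal_pow_anti; rewrite size_cbas_seq.
Qed.

Lemma ctrunc0 n : ctrunc n 0 = 0.
Proof. by apply: big1 => T _; rewrite /moment linear0 scale0r. Qed.

End Coordinates.

(** All moments of the sum vanish. In degree >= n this is because basis elements go to basis
    elements or 1, so that monomials of degree < n acquire no higher terms. In degree < n the low
    part is the whole sum minus the truncated one, and both lie in I^n. *)
Lemma push_clow_eq0 (S : finType) (P : pred S) (gT : S -> finGroupType)
    (hT : finGroupType) (k : forall s, coords (gT s)) (k' : coords hT)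
    (f : forall s, gT s -> hT) (x : forall s, galg 'F_2 (gT s)) (n : nat) :
    (forall s, P s -> {morph f s : g h / (g * h)%g}) ->
    (forall s i, P s -> f s (@cbas _ (k s) i) = 1%g \/
       exists j, f s (@cbas _ (k s) i) = @cbas _ k' j) ->
    \sum_(s | P s) galg_push (f s) (x s) \in aug_ideal_pow 'F_2 hT n%:Z ->
  \sum_(s | P s) galg_push (f s) (clow (k s) n (x s)) = 0.
Proof.
move=> fM fb xn; apply: (@coords_eq0 _ k') => T.
have [Tn|nT] := ltnP #|T| n; last first.
  rewrite linear_sum big1 // => s Ps /=; rewrite /clow !linear_sum big1 // => U Un.
  rewrite !linearZ /= galg_push_aug_prod; last exact: fM.
  rewrite [X in _ *: X](@moment_aug_prod_small _ k') ?scaler0 //; last first.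
    by rewrite size_map size_cbas_seq; lia.
  by move=> g /mapP[h /mapP[i _ ->] ->]; apply: fb.
have -> : \sum_(s | P s) galg_push (f s) (clow (k s) n (x s)) =
    \sum_(s | P s) galg_push (f s) (x s) -
    \sum_(s | P s) galg_push (f s) (ctrunc (k s) n (x s)).
  rewrite -sumrB; apply: eq_bigr => s _.
  by rewrite {2}(ctrunc_clow (k s) n (x s)) linearD /= addrAC subrr add0r.
rewrite linearB /= (galg_moment_aug_pow _ xn Tn); last exact: cfunM.
apply/eqP; rewrite sub0r oppr_eq0; apply/eqP.
rewrite linear_sum big1 // => s Ps /=; rewrite /ctrunc !linear_sum.
rewrite big1 // => U nU; rewrite !linearZ /= galg_push_aug_prod; last exact: fM.
rewrite [X in _ *: X](_ : _ = 0) ?scaler0 //.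
set t := map _ _.
apply: (@galg_moment_aug_pow _ _ _ _ _ (size t)).
- exact: cfunM.
- exact: mem_aug_prod.
- by rewrite size_map size_cbas_seq; lia.
Qed.

(** * Several projections of a single group algebra *)

Section TopStep.
Variables (gT : finGroupType) (k : coords gT).
Implicit Types (T Y : {set cidx k}) (x : galg 'F_2 gT).

Lemma cfun_inj (g h : gT) : (forall i, @cfun _ k i g = cfun i h) -> g = h.
Proof.
by move=> gh; rewrite -(cfun_expand k g) -(cfun_expand k h);
  apply: eq_bigr => i _; rewrite gh.
Qed.

Lemma coords_mulC (g h : gT) : (g * h)%g = (h * g)%g.
Proof. by apply: cfun_inj => i; rewrite !cfunM addrC. Qed.

Lemma coords_mulgg (g : gT) : (g * g)%g = 1%g.
Proof.
apply: cfun_inj => i; rewrite cfunM cfun1.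
by case: (F2P (cfun i g)) => ->; apply/val_inj.
Qed.

(** The coordinates in [T] are trivial on the kernel of [f], so they descend to additive functions
    on [hT], and the moment of [x] is a moment of its push-forward. *)
Lemma moment_push_aug (hT : finGroupType) (f : gT -> hT) T x (n : nat) :
    {morph f : g h / (g * h)%g} -> (forall h, exists g, f g = h) ->
    (forall i g, i \in T -> f g = 1%g -> @cfun _ k i g = 0) ->
    galg_push f x \in aug_ideal_pow 'F_2 hT n%:Z -> (#|T| < n)%N ->
  galg_moment (@cfun _ k) T x = 0.
Proof.
move=> fM fsurj fT xn Tn.
have /choice[pre preK] := fsurj.
have f1 : f 1%g = 1%g by apply: (mulgI (f 1%g)); rewrite -fM !mulg1.
have uE i g h : i \in T -> f g = f h -> cfun i g = @cfun _ k i h.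
  move=> iT fgh; apply/eqP; rewrite -subr_eq0; apply/eqP.
  rewrite -[RHS](fT i (g * h)%g iT); last by rewrite fM fgh -fM coords_mulgg f1.
  rewrite cfunM; case: (F2P (cfun i h)) => ->; rewrite ?subr0 ?addr0 //.
  by congr (_ + _); apply: val_inj.
(* Coordinates outside [T] need not descend; they are replaced by 0, so that additivity holds for
   every index. *)
pose u i h := if i \in T then @cfun _ k i (pre h) else 0.
have uM i g h : u i (g * h)%g = u i g + u i h.
  rewrite /u; case: ifP => iT; last by rewrite addr0.
  by rewrite -cfunM; apply: uE => //; rewrite fM !preK.
rewrite -(galg_moment_aug_pow uM xn Tn) galg_moment_push.
apply: eq_bigr => g _; congr (_ * _); apply: eq_bigr => i iT /=.
by rewrite /u iT; apply: uE; rewrite ?preK.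
Qed.

(** As b has square 1, b (b - 1) = 1 - b, and this is b - 1 in characteristic 2. *)
Lemma delta_aug_prod (s : seq gT) b : b \in s ->
  galg_delta 'F_2 b * aug_prod 'F_2 s = aug_prod 'F_2 s.
Proof.
elim: s => // g s IH; rewrite inE /aug_prod big_cons => /predU1P[<-|bs].
  rewrite mulrA mulrBr mulr1 -galg_deltaM coords_mulgg galg_delta1.
  congr (_ * _); rewrite -opprB -scaleN1r.
  by have -> : -1 = 1 :> 'F_2; [apply: val_inj|rewrite scale1r].
rewrite mulrA (galg_mulC coords_mulC (galg_delta 'F_2 b)) -mulrA.
by congr (_ * _); apply: IH.
Qed.

(** Here [Y] indexes basis elements that generate kernels of projections, and the nontrivial kernels
    contain some [z] in their span. Every monomial of the low part involves all of [Y], hence is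
    fixed by [z], and a [z]-invariant function has sum 0 over the fibres. *)
Lemma push_clow_top_eq0 (S : finType) (P : pred S) (hT : S -> finGroupType)
    (f : forall s, gT -> hT s) Y x (n : nat) :
    (forall s, P s -> {morph f s : g h / (g * h)%g}) ->
    (forall s h, P s -> exists g, f s g = h) ->
    (forall i, i \in Y -> exists2 s, P s &
       forall g, f s g = 1%g -> g = 1%g \/ g = @cbas _ k i) ->
    (forall s, P s -> (forall g, f s g = 1%g -> g = 1%g) \/
       exists z, [/\ z != 1%g, f s z = 1%g &
         forall i, i \notin Y -> @cfun _ k i z = 0]) ->
    (forall s, P s -> galg_push (f s) x \in aug_ideal_pow 'F_2 (hT s) n%:Z) ->
  forall s, P s -> galg_push (f s) (clow k n x) = 0.
Proof.
move=> fM fsurj Yf fY xn s Ps.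
(* If i in [Y] is missing from [T], the coordinates in [T] vanish on the kernel inside {1, [cbas i]}
   of some projection, so the coefficient is 0. *)
have hY T : (#|T| < n)%N -> galg_moment (@cfun _ k) T x != 0 -> Y \subset T.
  move=> Tn /eqP mT; apply/fintype.subsetP => i /Yf[t Pt ker].
  apply/negPn/negP => iT; apply: mT.
  apply: (moment_push_aug (fM t Pt) _ _ (xn t Pt) Tn) => [h|j g jT /ker]; first exact: fsurj.
  case=> ->; first exact: cfun1.
  by rewrite cfun_bas; case: eqP => // ji; rewrite -ji jT in iT.
(* With a trivial kernel all coordinates descend, and the low part itself is 0. *)
have [ker1|[z [z1 fz zY]]] := fY s Ps.
  rewrite /clow big1 ?linear0 // => T Tn.
  rewrite (moment_push_aug (fM s Ps) _ _ (xn s Ps) Tn) ?scale0r // => [h|i g _ /ker1 ->].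
    exact: fsurj.
  exact: cfun1.
set w := clow k n x.
have wz g : w (z * g)%g = w g.
  have {2}<- : galg_delta 'F_2 z * w = w; last first.
    rewrite galg_deltaME; congr (w (_ * _)%g).
    by apply: (mulgI z); rewrite mulgV coords_mulgg.
  rewrite /w /clow mulr_sumr; apply: eq_bigr => T Tn.
  have [->|mT] := eqVneq (galg_moment (@cfun _ k) T x) 0.
    by rewrite !scale0r mulr0.
  rewrite -scalerAr; congr (_ *: _).
  rewrite -(cfun_expand k z); apply: (big_ind (fun g : gT =>
    galg_delta 'F_2 g * cmonom T = cmonom T)).
  - by rewrite galg_delta1 mul1r.
  - by move=> a b aT bT; rewrite galg_deltaM -mulrA bT aT.
  move=> i _; case: (F2P (cfun i z)) => uz; rewrite uz.
    by rewrite expg0 galg_delta1 mul1r.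
  rewrite expg1; apply: delta_aug_prod; apply: map_f.
  rewrite mem_filter mem_index_enum andbT.
  apply: (fintype.subsetP (hY T Tn mT)); apply/negPn/negP => /zY.
  by rewrite uz => /eqP.
have [i uz] : exists i, @cfun _ k i z = 1.
  apply: contrapT => nz; move/eqP: z1; apply; apply: (@cfun_eq0 _ k) => i.
  by case: (F2P (cfun i z)) => // uz; case: nz; exists i.
(* A coordinate i with value 1 at [z] cuts each fibre into two halves exchanged by [z]; their equal
   sums cancel mod 2. *)
apply/ffunP => h; rewrite galg_0E ffunE (bigID (fun g => @cfun _ k i g == 0)) /=.
rewrite [X in _ + X](reindex_inj (mulgI z)) /=.
rewrite [X in _ + X](_ : _ = \sum_(g | (f s g == h) && (@cfun _ k i g == 0)) w g).
  by rewrite -mulr2n -mulr_natr (_ : 2%:R = 0 :> 'F_2) ?mulr0 //; apply: val_inj.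
apply: eq_big => [g|g _]; last exact: wz.
rewrite (fM s Ps) fz mul1g cfunM uz.
by case: (F2P (cfun i g)) => ->.
Qed.

End TopStep.

(** * Coordinates on quotients of F_2^d *)

Section F2Quotients.
Variable (d : nat).
Local Notation A := ('cV['F_2]_d).
Implicit Types (N : {group A}) (a b : A).

Lemma F2_addrr a : a + a = 0.
Proof.
apply/colP => i; rewrite !mxE; case: (F2P (a i 0)) => ->; first exact: addr0.
exact: val_inj.
Qed.

Lemma F2_oppr a : - a = a.
Proof. by apply/eqP; rewrite eq_sym -subr_eq0 opprK F2_addrr. Qed.

Lemma F2_mem_norm N a : a \in 'N(N)%g.
Proof.
apply/normP/setP => b; rewrite mem_conjg.
by rewrite conjgE invgK !FinRing.zmodMgE FinRing.zmodVgE addrCA subrr addr0.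
Qed.

Lemma cosetD N a b : coset N (a + b) = (coset N a * coset N b)%g.
Proof. by rewrite -morphM ?F2_mem_norm. Qed.

Lemma coset_eq1 N a : (coset N a == 1%g) = (a \in N).
Proof.
apply/eqP/idP => [|aN]; last exact: coset_id.
by apply: coset_idr; apply: F2_mem_norm.
Qed.

Lemma coset_mulgg N (g : coset_of N) : (g * g)%g = 1%g.
Proof.
by rewrite -(coset_reprK g) -cosetD F2_addrr; apply/eqP; rewrite coset_eq1 group1.
Qed.

Lemma coset_eq N a b : (coset N a == coset N b) = (a + b \in N).
Proof.
rewrite -coset_eq1 cosetD -eq_invg_mul; congr (_ == _).
by apply: (mulgI (coset N a)); rewrite mulgV coset_mulgg.
Qed.

Lemma repr_coset N a : a + fingroup.repr (coset N a) \in N.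
Proof. by rewrite -coset_eq coset_reprK. Qed.

Section ThresholdCoordinates.
Variables (m : nat) (V : {set 'I_m}) (fp : 'I_m -> A -> 'F_2) (N : {group A}).
Hypothesis fpD : forall i a b, fp i (a + b) = fp i a + fp i b.
Hypothesis NP : forall a,
  reflect {in V &, forall i j, fp i a = fp j a} (a \in N).
Hypothesis fpV : forall t : 'I_m -> 'F_2, exists a, {in V, forall i, fp i a = t i}.

(** The threshold [t] is an arbitrary natural number and not an element of [V], so that a threshold
    class keeps its [t] when [V] shrinks. *)
Definition threshold (g : coset_of N) (t : nat) :=
  exists2 a, g = coset N a & {in V, forall j : 'I_m, fp j a = (t <= j)%N%:R}.

(* The coordinates are the sums of consecutive fp i, i in V. *)
Lemma threshold_coords : exists k : coords (coset_of N),
  (forall i, exists t, threshold (@cbas _ k i) t) /\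
  (forall g t, threshold g t -> g = 1%g \/ exists i, g = @cbas _ k i).
Proof.
(* The indices are the elements of [V] other than the least one; each is paired below with its
   predecessor [p i] in [V]. *)
pose Q (i : 'I_m) := (i \in V) && [exists j in V, (j < i)%N].
pose idx := {i : 'I_m | Q i}.
have /choice[p pP] : forall i : idx, exists p : 'I_m,
    [/\ p \in V, (p < val i)%N & forall j, j \in V -> (j < val i)%N -> (j <= p)%N].
  move=> [i /= /andP[iV /exists_inP[j0 j0V j0i]]].
  pose B (j : 'I_m) := (j \in V) && (j < i)%N.
  have [|p /andP[pV pi] pmax] := @arg_maxnP _ j0 B (fun j => j).
    by rewrite /B j0V.
  by exists p; split=> // j jV ji; apply: pmax; rewrite /B jV.
have /choice[a aP] : forall i : idx, exists a,
    {in V, forall j : 'I_m, fp j a = (val i <= j)%N%:R}.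
  by move=> i; apply: fpV.
have VI (i : idx) : val i \in V by case: i => i /= /andP[].
pose u (i : idx) (g : coset_of N) : 'F_2 :=
  fp (val i) (fingroup.repr g) + fp (p i) (fingroup.repr g).
have fpN i j b : i \in V -> j \in V -> b \in N -> fp i b + fp j b = 0.
  move=> iV jV /NP bN; rewrite (bN i j iV jV); case: (F2P (fp j b)) => ->.
    exact: addr0.
  exact: val_inj.
have uE i b : u i (coset N b) = fp (val i) b + fp (p i) b.
  have [pV _ _] := pP i.
  have := repr_coset N b; set c := b + _ => cN.
  have rE : fingroup.repr (coset N b) = b + c by rewrite addrA F2_addrr add0r.
  clearbody c; by rewrite /u rE !fpD addrACA (fpN _ _ _ (VI i) pV cN) addr0.
have uM i g h : u i (g * h)%g = u i g + u i h.
  rewrite -(coset_reprK g) -(coset_reprK h) -cosetD !uE !fpD.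
  by rewrite addrACA.
have u0 g : (forall i, u i g = 0) -> g = 1%g.
  (* Vanishing of all consecutive sums makes the values constant along [V], by descent to the least
     element [i0]. *)
  move=> ug; rewrite -(coset_reprK g); apply/eqP; rewrite coset_eq1.
  set b := fingroup.repr g; apply/NP => i1 j1 i1V j1V.
  have [i0 i0V i0min] := @arg_minnP _ i1 (mem V) (fun j => j) i1V.
  suff h i : i \in V -> fp i b = fp i0 b by rewrite !h.
  have [n] := ubnP (i : nat); elim: n i => // n IH i lin iV.
  have [Qi|nQ] := boolP (Q i).
    pose i' : idx := Sub i Qi; have [pV pi _] := pP i'.
    rewrite -(IH (p i')) //; last exact: leq_trans pi lin.
    have /eqP := ug i'; rewrite /u addr_eq0 => /eqP ->.
    by case: (F2P (fp (p i') b)) => ->; [rewrite oppr0|apply: val_inj].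
  congr fp; apply: val_inj; apply/eqP; rewrite eqn_leq i0min // andbT leqNgt.
  by apply: contra nQ => i0i; rewrite /Q iV; apply/exists_inP; exists i0.
(* The values of [a j] jump exactly at [j], so a consecutive pair sees the jump only if its upper
   element is [j]. *)
have ub i j : u i (coset N (a j)) = (i == j)%:R.
  have [pV pi pmax] := pP i.
  rewrite uE !aP ?VI //.
  have [ji|ij] := leqP (val j) (val i); last first.
    have /negPf -> : i != j by apply: contraTN ij => /eqP ->; rewrite ltnn.
    have -> : (val j <= p i)%N = false.
      by apply/negbTE; rewrite -ltnNge (ltn_trans pi).
    exact: addr0.
  have [jp|pj] := leqP (val j) (p i).
    have /negPf -> : i != j.
      by apply: contraTN jp => /eqP <-; rewrite -ltnNge.
    by apply/eqP.
  have -> : i = j.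
    apply: val_inj; apply: val_inj; apply/eqP; rewrite eqn_leq ji andbT leqNgt.
    by apply/negP => /(pmax _ (VI j)); rewrite leqNgt pj.
  by rewrite eqxx addr0.
pose k := Coords uM u0 ub.
exists k; split=> [i|g t [b -> bt]]; first by exists (val i), (a i) => //; apply: aP.
(* A threshold above all of [V], or at most its minimum, gives a constant vector and the trivial
   class. Any other has the effect of the least element [j0] of [V] not below it. *)
have [/exists_inP[j1 j1V tj1]|none] := boolP [exists j in V, (t <= j)%N]; last first.
  left; apply/eqP; rewrite coset_eq1; apply/NP => i j iV jV.
  have z l : l \in V -> fp l b = 0.
    move=> lV; rewrite bt //; case: leqP => // tl.
    by case/negP: none; apply/exists_inP; exists l.
  by rewrite !z.
pose B (j : 'I_m) := (j \in V) && (t <= j)%N.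
have [|j0 /andP[j0V tj0] j0min] := @arg_minnP _ j1 B (fun j => j).
  by rewrite /B j1V.
have tE (j : 'I_m) : j \in V -> (t <= j)%N = (j0 <= j)%N.
  move=> jV; apply/idP/idP => [tj|]; first by apply: j0min; rewrite /B jV.
  exact: leq_trans tj0.
have [Qj0|nQ] := boolP (Q j0); last first.
  left; apply/eqP; rewrite coset_eq1; apply/NP => i j iV jV.
  have z (l : 'I_m) : l \in V -> fp l b = 1.
    move=> lV; rewrite bt // tE // leqNgt; case: ltnP => // lj0.
    by case/negP: nQ; rewrite /Q j0V; apply/exists_inP; exists l.
  by rewrite !z.
right; exists (Sub j0 Qj0 : idx); apply/eqP; rewrite /= coset_eq.
have z (l : 'I_m) : l \in V -> fp l (b + a (Sub j0 Qj0)) = 0.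
  move=> lV; rewrite fpD bt // aP //= tE //.
  by case: (j0 <= l)%N; [apply: val_inj|rewrite addr0].
by apply/NP => i j iV jV; rewrite !z.
Qed.

End ThresholdCoordinates.

Lemma free_subspanning (X : seq A) : exists Y : seq A,
  [/\ free Y, {subset Y <= X} & (<<X>> <= <<Y>>)%VS].
Proof.
elim: X => [|x X [Y [Yf YX XY]]].
  by exists [::]; split=> //; rewrite ?nil_free ?subvv.
have [xY|xY] := boolP (x \in <<Y>>%VS).
  exists Y; split=> // [y /YX yX|]; first by rewrite inE yX orbT.
  by rewrite span_cons subv_add XY -memvE xY.
exists (x :: Y); split; first by rewrite free_cons xY.
  by move=> y; rewrite !inE => /predU1P[->|/YX ->]; rewrite ?eqxx ?orbT.
by rewrite !span_cons addvS.
Qed.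

(** A maximal independent part of [X] is extended to a basis of the whole space by a basis of a
    complement. *)
Lemma spanning_coords N (X : seq A) : (forall a, a \in N -> a = 0) ->
  exists (k : coords (coset_of N)) (Y : {set cidx k}),
    (forall i, i \in Y -> exists2 x, x \in X & @cbas _ k i = coset N x) /\
    (forall x i, x \in X -> i \notin Y -> @cfun _ k i (coset N x) = 0).
Proof.
move=> N0; have [Y [Yf YX XY]] := free_subspanning X.
pose t := Y ++ vbasis (<<Y>>^C)%VS.
have tf : free t.
  rewrite /t cat_free Yf (basis_free (vbasisP _)) /=.
  by rewrite directv_addE /= !directv_trivial (span_basis (vbasisP _)) capv_compl /=.
have tspan : <<t>>%VS = fullv.
  by rewrite /t span_cat (span_basis (vbasisP _)) addv_complf.
pose T := in_tuple t.
have reprK a : fingroup.repr (coset N a) = a.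
  have /N0/eqP := repr_coset N a; rewrite addr_eq0 F2_oppr => /eqP.
  by [].
pose u (i : 'I_(size t)) (g : coset_of N) := coord T i (fingroup.repr g) : 'F_2.
have uM i g h : u i (g * h)%g = u i g + u i h.
  by rewrite -{1}(coset_reprK g) -{1}(coset_reprK h) -cosetD /u reprK linearD.
have u0 g : (forall i, u i g = 0) -> g = 1%g.
  move=> ug; rewrite -(coset_reprK g) (@coord_span _ _ _ T (fingroup.repr g)) ?tspan ?memvf //.
  rewrite big1 => [|i _]; last by rewrite -/(u i g) ug scale0r.
  by apply/eqP; rewrite coset_eq1 group1.
have ub i (j : 'I_(size t)) : u i (coset N t`_j) = (i == j)%:R.
  by rewrite /u reprK (coord_free _ _ (tf : free T)) eq_sym.
exists (Coords uM u0 ub), [set i : 'I_(size t) | (i < size Y)%N]%SET; split=> [i|x i xX].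
  rewrite finset.inE => iY; exists t`_i => //; apply: YX.
  by rewrite /t nth_cat iY mem_nth.
rewrite finset.inE => iY /=; rewrite /u reprK.
(* A coordinate beyond those of [Y] vanishes on the span of [Y], which contains [X]. *)
have : (<<Y>> <= lker (linfun (coord T i : A -> ('F_2)^o)))%VS.
  apply/span_subvP => y yY; rewrite memv_ker lfunE /=.
  have yI : (index y Y < size t)%N.
    by rewrite size_cat ltn_addr // index_mem.
  have -> : y = T`_(Ordinal yI) by rewrite /= /t nth_cat index_mem yY nth_index.
  rewrite (coord_free _ _ (tf : free T)).
  case: (eqVneq i (Ordinal yI)) => [iE|_]; last by rewrite eqxx.
  by case/negP: iY; rewrite iE /= index_mem.
move/subvP => /(_ x (subvP XY _ (memv_span xX))).
by rewrite memv_ker lfunE => /eqP.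
Qed.

End F2Quotients.

(** * Normal fans of polytopes *)

Lemma mem_linspan (K : fieldType) (V : vectType K) (S : set V) x :
  S x -> x \in linspan S.
Proof. by have [h _] := linspanP S; apply: h. Qed.

Lemma linspan_sub (K : fieldType) (V : vectType K) (S : set V) (W : {vspace V}) :
  (forall x, S x -> x \in W) -> (linspan S <= W)%VS.
Proof. by have [_ h] := linspanP S; apply: h. Qed.

Section Pairing.
Variables (R : realType) (d : nat).
Implicit Types (x y : 'rV[R]_d) (u v : 'cV[R]_d).

Fact pairing_is_linear x : scalar (@pairing R d x).
Proof. by move=> a u v; rewrite /pairing mulmxDr -scalemxAr !mxE. Qed.
HB.instance Definition _ x :=
  GRing.isLinear.Build R 'cV[R]_d R *%R (@pairing R d x) (pairing_is_linear x).

Lemma pairingDl x y u : pairing (x + y) u = pairing x u + pairing y u.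
Proof. by rewrite /pairing mulmxDl mxE. Qed.

Lemma pairingZl a x u : pairing (a *: x) u = a * pairing x u.
Proof. by rewrite /pairing -scalemxAl mxE. Qed.

Lemma pairingBl x y u : pairing (x - y) u = pairing x u - pairing y u.
Proof. by rewrite pairingDl -scaleN1r pairingZl mulN1r. Qed.

Lemma pairing0l u : pairing 0 u = 0 :> R.
Proof. by rewrite /pairing mul0mx mxE. Qed.

Lemma pairing_suml (I : Type) (r : seq I) (P : pred I) (F : I -> 'rV[R]_d) u :
  pairing (\sum_(i <- r | P i) F i) u = \sum_(i <- r | P i) pairing (F i) u.
Proof. by rewrite /pairing mulmx_suml summxE. Qed.

Lemma scalar_pairing (f : {scalar 'rV[R]_d}) :
  exists u, forall x, f x = pairing x u.
Proof.
exists (\col_j f (delta_mx 0 j)) => x.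
rewrite {1}(row_sum_delta x) linear_sum /pairing mxE; apply: eq_bigr => j _.
by rewrite linearZ /= mxE.
Qed.

Lemma pairing_scalar u :
  exists f : {scalar 'rV[R]_d}, forall x, f x = pairing x u.
Proof.
have lin : scalar (fun x : 'rV[R]_d => pairing x u).
  by move=> a x y; rewrite pairingDl pairingZl.
pose f : {scalar 'rV[R]_d} := HB.pack (fun x : 'rV[R]_d => pairing x u)
  (GRing.isLinear.Build R 'rV[R]_d R *%R _ lin).
by exists f.
Qed.

Lemma mulmx_eq0_pairing x u : (x *m u == 0) = (pairing x u == 0).
Proof.
apply/eqP/eqP => [xu0|xu0]; first by rewrite /pairing xu0 mxE.
by apply/matrixP => i j; rewrite !ord1 [RHS]mxE.
Qed.

End Pairing.

(** The constant exceeds every ratio |g i / f i|, so its multiple of [f] dominates [g] wherever [f]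
    is positive. *)
Lemma perturbation (R : realType) (I : finType) (f g : I -> R) :
  exists2 l : R, 0 < l & forall i, 0 < f i -> 0 < l * f i + g i.
Proof.
exists (1 + \sum_i `|g i / f i|) => [|i fi].
  by rewrite ltr_pwDl // sumr_ge0.
have le : `|g i / f i| <= \sum_i `|g i / f i|.
  by rewrite (bigD1 i) //= lerDl sumr_ge0.
have gE : `|g i / f i| * f i = `|g i|.
  by rewrite normrM normrV ?unitfE ?gt_eqF // (gtr0_norm fi) mulfVK ?gt_eqF.
have := ler_wpM2r (ltW fi) le; rewrite gE mulrDl mul1r => h.
have : - g i <= `|g i| by rewrite -normrN ler_norm.
lra.
Qed.

Lemma conv_hull_nth (R : realType) (V : vectType R) (s : seq V)
  (i : 'I_(size s)) : conv_hull s s`_i.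
Proof.
exists (fun k => (k == i)%:R); split=> [k|| ]; first exact: ler0n.
  by rewrite (bigD1 i) //= eqxx big1 ?addr0 // => k /negPf ->.
rewrite (bigD1 i) //= eqxx scale1r big1 ?addr0 // => k /negPf ->.
by rewrite scale0r.
Qed.

Section PolytopeFan.
Variables (R : realType) (d : nat) (s : seq 'rV[R]_d).
Local Notation I := 'I_(size s).
Implicit Types (i j : I) (A B : {set I}) (u v w n : 'cV[R]_d).

Let P := conv_hull s.

Definition ev i u : R := pairing s`_i u.

Lemma evD i u v : ev i (u + v) = ev i u + ev i v.
Proof. exact: linearD. Qed.
Lemma evZ i a u : ev i (a *: u) = a * ev i u.
Proof. exact: linearZ. Qed.

(** A face is encoded by the indices of all generators lying on it; generators may repeat and need
    not be vertices. *)
Definition argmin u : {set I} := [set i | [forall j, ev i u <= ev j u]]%SET.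

Lemma argminP i u : reflect (forall j, ev i u <= ev j u) (i \in argmin u).
Proof. by rewrite inE; apply: forallP. Qed.

Lemma argmin_eq i j u : i \in argmin u -> j \in argmin u -> ev i u = ev j u.
Proof. by move=> /argminP iu /argminP ju; apply/eqP; rewrite eq_le iu ju. Qed.

Lemma argmin_lt i j u : i \in argmin u -> j \notin argmin u -> ev i u < ev j u.
Proof.
move=> iu ju; rewrite lt_neqAle (argminP _ _ iu) andbT.
apply: contra ju => /eqP ij; apply/argminP => k; rewrite -ij; exact: (argminP _ _ iu).
Qed.

Lemma argminE i j u : i \in argmin u -> (j \in argmin u) = (ev j u == ev i u).
Proof.
move=> iu; apply/idP/eqP => [ju|ji]; first exact: argmin_eq.
by apply/argminP => k; rewrite ji; apply: (argminP _ _ iu).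
Qed.

Lemma argmin_neq0 u : (0 < size s)%N -> exists i, i \in argmin u.
Proof.
move=> s0; pose i0 := Ordinal s0.
have [i _ imin] := @arg_minP _ _ _ i0 xpredT (ev^~ u) isT.
by exists i; apply/argminP => j; apply: imin.
Qed.

Lemma pairing_conv (a : I -> R) u :
  pairing (\sum_i a i *: s`_i) u = \sum_i a i * ev i u.
Proof. by rewrite pairing_suml; apply: eq_bigr => i _; rewrite pairingZl. Qed.

Lemma conv_hull_ge (b : R) u : (forall i, b <= ev i u) ->
  forall x, P x -> b <= pairing x u.
Proof.
move=> bu x [a [a0 a1 ->]]; rewrite pairing_conv -[b]mul1r -a1 mulr_suml.
by apply: ler_sum => i _; apply: ler_wpM2l.
Qed.

(** The excesses over the lower bound [b], weighted by [a], are nonnegative with sum 0. *)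
Lemma conv_hull_supp (a : I -> R) (b : R) u :
    (forall i, 0 <= a i) -> \sum_i a i = 1 -> (forall i, b <= ev i u) ->
    pairing (\sum_i a i *: s`_i) u <= b ->
  forall i, a i != 0 -> ev i u = b.
Proof.
move=> a0 a1 bu; rewrite pairing_conv => le i ai.
have sum0 : \sum_i a i * (ev i u - b) = 0.
  under eq_bigr do rewrite mulrBr.
  rewrite sumrB -mulr_suml a1 mul1r; apply/eqP; rewrite subr_eq0 eq_le le /=.
  rewrite -[b]mul1r -a1 mulr_suml.
  by apply: ler_sum => j _; apply: ler_wpM2l.
have ge0 k : true -> 0 <= a k * (ev k u - b).
  by move=> _; apply: mulr_ge0 => //; rewrite subr_ge0.
have /eqP := @psumr_eq0P _ _ xpredT _ ge0 sum0 i isT.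
by rewrite mulf_eq0 (negPf ai) subr_eq0 => /eqP.
Qed.

Definition face_of u : set 'rV[R]_d :=
  [set x | P x /\ forall y, P y -> pairing x u <= pairing y u].

Lemma is_face_of u : is_face P (face_of u).
Proof.
have [f fu] := pairing_scalar u; exists f.
by apply/seteqP; split=> x [Px xmin]; split=> // y /xmin; rewrite !fu.
Qed.

Lemma is_face_conv_hull F : is_face P F -> exists u, F = face_of u.
Proof.
case=> f ->; have [u fu] := scalar_pairing f; exists u.
by apply/seteqP; split=> x [Px xmin]; split=> // y /xmin; rewrite !fu.
Qed.

Lemma face_of_nth i u : face_of u s`_i <-> i \in argmin u.
Proof.
split=> [[_ imin]|/argminP imin].
  by apply/argminP => j; apply: imin; apply: conv_hull_nth.
by split; [exact: conv_hull_nth|apply: conv_hull_ge].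
Qed.

Lemma face_of_supp (a : I -> R) u :
    (forall i, 0 <= a i) -> \sum_i a i = 1 -> face_of u (\sum_i a i *: s`_i) ->
  forall i, a i != 0 -> i \in argmin u.
Proof.
move=> a0 a1 [_ xmin] i ai; apply/argminP => j.
rewrite (@conv_hull_supp a (pairing (\sum_i a i *: s`_i) u) u) //.
  exact/xmin/conv_hull_nth.
by move=> k; apply/xmin/conv_hull_nth.
Qed.

Definition ncone A : set 'cV[R]_d := [set n | A \subset argmin n].

Lemma normal_cone_face_of u : normal_cone P (face_of u) = ncone (argmin u).
Proof.
apply/seteqP; split=> n /= nP.
  apply/fintype.subsetP => i iu; apply/argminP => j.
  by apply: nP; [exact/face_of_nth|exact: conv_hull_nth].
move=> x y xF; have [[a [a0 a1 xE]] _] := xF.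
have supp := @face_of_supp a u a0 a1; rewrite -xE in supp.
apply: conv_hull_ge => j; rewrite xE pairing_conv -[leRHS]mul1r -a1 mulr_suml.
apply: ler_sum => i _; have [->|ai] := eqVneq (a i) 0; first by rewrite !mul0r.
apply: ler_wpM2l => //; apply/argminP.
exact: (fintype.subsetP nP i (supp xF i ai)).
Qed.

Hypothesis s_gt0 : (0 < size s)%N.

Lemma normal_fanE C : normal_fan P C <-> exists u, C = ncone (argmin u).
Proof.
split=> [[F [/is_face_conv_hull[u ->] _ ->]]|[u ->]].
  by exists u; apply: normal_cone_face_of.
exists (face_of u); split; [exact: is_face_of| |by rewrite normal_cone_face_of].
by have [i iu] := argmin_neq0 u s_gt0; exists s`_i; apply/face_of_nth.
Qed.

Lemma ncone_argmin u : ncone (argmin u) u.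
Proof. exact: subxx. Qed.

Lemma ncone_subset u w :
  (ncone (argmin u) `<=` ncone (argmin w))%classic <-> argmin w \subset argmin u.
Proof.
split=> [|wu n un]; first by apply; apply: ncone_argmin.
exact: fintype.subset_trans wu un.
Qed.

Lemma ncone_inj u w : ncone (argmin u) = ncone (argmin w) -> argmin u = argmin w.
Proof.
move=> E; apply/eqP; rewrite finset.eqEsubset; apply/andP.
by split; apply/ncone_subset; rewrite E.
Qed.

Lemma is_face_ncone u w :
  is_face (ncone (argmin w)) (ncone (argmin u)) <-> argmin w \subset argmin u.
Proof.
split=> [[f fE]|wu].
  by apply/ncone_subset => n; rewrite fE => -[].
have [j jw] := argmin_neq0 w s_gt0.
(* With [j] minimal for all functionals in the larger cone, each summand is nonnegative there, and
   all vanish exactly on the functionals minimal on the whole of [argmin u]. *)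
exists (pairing (\sum_(i in argmin u) (s`_i - s`_j))).
have fE n : pairing (\sum_(i in argmin u) (s`_i - s`_j)) n =
    \sum_(i in argmin u) (ev i n - ev j n).
  by rewrite pairing_suml; apply: eq_bigr => i _; rewrite pairingBl.
have ge0 n : ncone (argmin w) n ->
    forall i, i \in argmin u -> 0 <= ev i n - ev j n.
  by move=> nw i _; rewrite subr_ge0; apply/argminP/(fintype.subsetP nw).
apply/seteqP; split=> n /= nu.
  have nw : ncone (argmin w) n by exact: fintype.subset_trans wu nu.
  split=> // y yw; rewrite !fE big1 ?sumr_ge0 // => [|i iu]; first exact: ge0.
  apply/eqP; rewrite subr_eq0; apply/eqP/(@argmin_eq _ _ n).
    exact: (fintype.subsetP nu).
  exact: (fintype.subsetP nw).
have [nw nmin] := nu.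
apply/fintype.subsetP => i iu.
rewrite (argminE _ (fintype.subsetP nw _ jw)) -subr_eq0; apply/eqP.
have zw : ncone (argmin w) 0.
  by apply/fintype.subsetP => k _; apply/argminP => l; rewrite /ev !linear0.
have := nmin _ zw; rewrite linear0 fE => le0.
have sum0 : \sum_(i in argmin u) (ev i n - ev j n) = 0.
  by apply/eqP; rewrite eq_le le0 sumr_ge0 // => k; apply: ge0.
exact: (psumr_eq0P (ge0 n nw) sum0).
Qed.

(** The orthogonal complement of the directions of a face; for [argmin u] it is the span of the
    normal cone, by [linspan_ncone]. *)
Definition dirspace A : {vspace 'cV[R]_d} :=
  (\bigcap_(ij : I * I | (ij.1 \in A) && (ij.2 \in A))
     lker (linfun (mulmx (s`_ij.1 - s`_ij.2) : 'cV[R]_d -> 'cV[R]_1)))%VS.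

Lemma dirspaceP A n :
  reflect {in A &, forall i j, ev i n = ev j n} (n \in dirspace A).
Proof.
have kerE i j : (n \in lker (linfun (mulmx (s`_i - s`_j) : 'cV[R]_d -> 'cV[R]_1)))
    = (ev i n == ev j n).
  by rewrite memv_ker lfunE /= mulmx_eq0_pairing pairingBl subr_eq0.
apply: (iffP idP) => [nA i j iA jA|nA].
  apply/eqP; rewrite -kerE; apply: (subvP _ _ nA).
  by apply: (bigcapv_inf (i, j)); [rewrite /= iA jA|exact: subvv].
rewrite memvE; apply/subv_bigcapP => -[i j] /andP[/= iA jA].
by rewrite -memvE kerE; apply/eqP/nA.
Qed.

Lemma mem_dirspace_argmin u : u \in dirspace (argmin u).
Proof. by apply/dirspaceP => i j iu ju; apply: argmin_eq. Qed.

Lemma dirspace_anti A B : A \subset B -> (dirspace B <= dirspace A)%VS.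
Proof.
move=> /fintype.subsetP AB; apply/subvP => n /dirspaceP nB.
by apply/dirspaceP => i j /AB iA /AB jA; apply: nB.
Qed.

(** On [argmin u] the perturbation [w] is constant, and elsewhere a large multiple of [u] outweighs
    it. *)
Lemma argmin_perturb u w : w \in dirspace (argmin u) ->
  exists2 l, 0 < l & argmin (l *: u + w) = argmin u.
Proof.
move=> wu; have [i0 i0u] := argmin_neq0 u s_gt0.
have [l l0 lP] := perturbation (fun i => ev i u - ev i0 u)
  (fun i => ev i w - ev i0 w).
exists l => //; apply/setP => j.
have le k : ev i0 (l *: u + w) <= ev k (l *: u + w).
  rewrite -subr_ge0 !evD !evZ opprD addrACA -mulrBr.
  have [ku|ku] := boolP (k \in argmin u).
    rewrite (argmin_eq ku i0u) (dirspaceP _ _ wu k i0 ku i0u) !subrr.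
    by rewrite mulr0 addr0.
  by apply/ltW/lP; rewrite subr_gt0 argmin_lt.
have i0l : i0 \in argmin (l *: u + w) by apply/argminP.
rewrite (argminE _ i0l); have [ju|ju] := boolP (j \in argmin u).
  rewrite !evD !evZ (argmin_eq ju i0u) (dirspaceP _ _ wu j i0 ju i0u).
  by rewrite eqxx.
apply/negbTE; rewrite -subr_eq0 !evD !evZ opprD addrACA -mulrBr.
by rewrite gt_eqF // lP // subr_gt0 argmin_lt.
Qed.

(** Any [n] in [dirspace (argmin u)] is the difference of [l *: u + n] and [l *: u], both in the
    cone for [l] large. *)
Lemma linspan_ncone u : linspan (ncone (argmin u)) = dirspace (argmin u).
Proof.
apply/eqP; rewrite eqEsubv; apply/andP; split.
  apply: linspan_sub => n /fintype.subsetP nu.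
  by apply/dirspaceP => i j /nu iA /nu jA; apply: argmin_eq.
apply/subvP => n nu; have [l l0 lE] := argmin_perturb nu.
have -> : n = (l *: u + n) - l *: u by rewrite addrAC subrr add0r.
apply: memvB; last by apply/memvZ/mem_linspan/ncone_argmin.
by apply/mem_linspan; rewrite /ncone /= lE.
Qed.

End PolytopeFan.

(** * Intervals of length two in the normal fan *)

Lemma root_le (R : realFieldType) (f g t t' : R) :
  f + t * g = 0 -> 0 <= f + t' * g -> 0 < g -> t <= t'.
Proof. by move=> e le g0; rewrite -(ler_pM2r g0); lra. Qed.

Lemma root_ge (R : realFieldType) (f g t t' : R) :
  f + t * g = 0 -> 0 <= f + t' * g -> g < 0 -> t' <= t.
Proof. by move=> e le g0; rewrite -(ler_nM2r g0); lra. Qed.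

Section Diamond.
Variables (R : realType) (d : nat) (s : seq 'rV[R]_d).
Hypothesis s_gt0 : (0 < size s)%N.
Local Notation I := 'I_(size s).
Local Notation argmin := (@argmin R d s).
Local Notation ev := (@ev R d s).
Local Notation dirspace := (@dirspace R d s).
Implicit Types (i j q : I) (A B : {set I}) (u v w n : 'cV[R]_d).

(* A half-line inside a plane slice of a cone, leaving it through one facet. *)
Lemma exit_point (A : {set I}) (f g : I -> R) :
    (exists2 q, q \in A & g q < 0) ->
    (forall q, q \in A -> g q < 0 -> 0 < f q) ->
    (forall q, q \in A -> 0 <= f q) ->
  exists t, [/\ 0 < t, forall q, q \in A -> 0 <= f q + t * g q &
    exists q, [/\ q \in A, g q < 0 & f q + t * g q = 0]].
Proof.
move=> [q0 q0A gq0] fpos f0; pose Q q := (q \in A) && (g q < 0).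
have Qq0 : Q q0 by rewrite /Q q0A.
have [q /andP[qA gq] qmin] := @arg_minP _ _ _ q0 Q (fun q => f q / - g q) Qq0.
have t0 : 0 < f q / - g q by rewrite divr_gt0 ?fpos ?oppr_gt0.
exists (f q / - g q); split=> // [k kA|]; last first.
  exists q; split=> //; rewrite invrN mulrN mulNr mulfVK ?subrr //.
  by rewrite lt_eqF.
have [gk|gk] := ltrP (g k) 0; last first.
  by rewrite addr_ge0 ?f0 // mulr_ge0 // ltW.
have : f q / - g q <= f k / - g k by apply: qmin; rewrite /Q kA.
by rewrite ler_pdivlMr ?oppr_gt0 // mulrN lerNl -subr_ge0 opprK addrC.
Qed.

Variables (us ur : 'cV[R]_d).
Let A := argmin us.
Let B := argmin ur.
Hypothesis BA : B \subset A.
Hypothesis dimBA : \dim (dirspace B) = (\dim (dirspace A)).+2.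

Let intermediate v := [/\ B \subset argmin v, argmin v \subset A &
  \dim (dirspace (argmin v)) = (\dim (dirspace A)).+1].

(** From [ur] one moves along [w1] until a generator in [A] outside [B] ties with [B]; a large
    multiple of [us] keeps the generators outside [A] strictly above. The new tie brings the
    dimension below that of [B], and [qp], which does not tie, keeps it above that of [A]. *)
Lemma exit_facet j0 w1 : j0 \in B -> w1 \in dirspace B ->
    (exists2 q, q \in A & ev q w1 - ev j0 w1 < 0) ->
    (exists2 q, q \in A & 0 < ev q w1 - ev j0 w1) ->
  exists v t, [/\ intermediate v, 0 < t,
    forall q, q \in A -> 0 <= ev q ur - ev j0 ur + t * (ev q w1 - ev j0 w1),
    (exists q, [/\ q \in A, ev q w1 - ev j0 w1 < 0 &
      ev q ur - ev j0 ur + t * (ev q w1 - ev j0 w1) = 0]) &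
    argmin v = [set q in A | ev q ur - ev j0 ur + t * (ev q w1 - ev j0 w1) == 0]%SET].
Proof.
move=> j0B w1B neg [qp qpA gqp].
have j0A : j0 \in A := fintype.subsetP BA _ j0B.
pose f q := ev q ur - ev j0 ur; pose g q := ev q w1 - ev j0 w1.
have f0 q : 0 <= f q by rewrite subr_ge0; apply/argminP.
have gB q : q \in B -> g q = 0.
  by move=> qB; apply/eqP; rewrite subr_eq0; apply/eqP/(dirspaceP _ _ w1B).
have fpos q : q \notin B -> 0 < f q by move=> qB; rewrite subr_gt0 argmin_lt.
have [|t [t0 tA [qm [qmA gqm tqm]]]] := @exit_point A f g neg _ (fun q _ => f0 q).
  by move=> q _ gq; apply: fpos; apply/negP => /gB gq0; rewrite gq0 ltxx in gq.
have [l l0 lP] := perturbation (fun q => ev q us - ev j0 us)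
  (fun q => f q + t * g q).
pose v := l *: us + (ur + t *: w1).
have vE q : ev q v - ev j0 v = l * (ev q us - ev j0 us) + (f q + t * g q).
  by rewrite /v /f /g !evD !evZ; ring.
have usA q : q \in A -> ev q us - ev j0 us = 0.
  by move=> qA; rewrite (argmin_eq qA j0A) subrr.
have j0v : j0 \in argmin v.
  apply/argminP => q; rewrite -subr_ge0 vE.
  have [qA|qA] := boolP (q \in A); first by rewrite usA // mulr0 add0r tA.
  by apply/ltW/lP; rewrite subr_gt0 argmin_lt.
have argv : argmin v = [set q in A | f q + t * g q == 0]%SET.
  apply/setP => q; rewrite (argminE _ j0v) -subr_eq0 vE finset.inE.
  have [qA|qA] := boolP (q \in A); first by rewrite usA // mulr0 add0r.
  by rewrite gt_eqF // lP // subr_gt0 argmin_lt.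
have BV : B \subset argmin v.
  rewrite argv; apply/fintype.subsetP => q qB.
  by rewrite finset.inE (fintype.subsetP BA) //= gB // mulr0 addr0 /f
    (argmin_eq qB j0B) subrr.
have VA : argmin v \subset A.
  by rewrite argv; apply/fintype.subsetP => q; rewrite finset.inE => /andP[].
exists v, t; split=> //; last by exists qm.
split=> //; apply/eqP; rewrite eqn_leq; apply/andP; split.
  rewrite -ltnS -dimBA ltnNge; apply/negP => le.
  have /eqP E : dirspace (argmin v) == dirspace B by rewrite eqEdim dirspace_anti.
  have : ur \in dirspace (argmin v) by rewrite E mem_dirspace_argmin.
  have qmv : qm \in argmin v by rewrite argv finset.inE qmA tqm eqxx.
  move/dirspaceP => /(_ qm j0 qmv j0v) /eqP; rewrite -subr_eq0 gt_eqF // fpos //.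
  by apply/negP => /gB gq0; rewrite gq0 ltxx in gqm.
rewrite ltnNge; apply/negP => le.
have /eqP E : dirspace A == dirspace (argmin v) by rewrite eqEdim dirspace_anti.
have : v \in dirspace A by rewrite E mem_dirspace_argmin.
move/dirspaceP => /(_ qp j0 qpA j0A) /eqP; rewrite -subr_eq0 vE usA // mulr0 add0r.
by rewrite gt_eqF // ltr_wpDl // mulr_gt0.
Qed.

(** Modulo [dirspace A] the cone of functionals minimal on [B] becomes a pointed cone in a plane.
    Its slice by a line is a segment, whose two ends are the intermediate cones. *)
Lemma diamond : exists v1 v2, argmin v1 != argmin v2 /\
  forall v, intermediate v <-> argmin v = argmin v1 \/ argmin v = argmin v2.
Proof.
have [j0 j0B] := argmin_neq0 ur s_gt0; rewrite -/B in j0B.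
have j0A : j0 \in A := fintype.subsetP BA _ j0B.
pose l q n := ev q n - ev j0 n.
have lD q a b : l q (a + b) = l q a + l q b by rewrite /l !evD; ring.
have lZ q c a : l q (c *: a) = c * l q a by rewrite /l !evZ; ring.
have lA q a : a \in dirspace A -> q \in A -> l q a = 0.
  by move=> /dirspaceP aA qA; apply/eqP; rewrite subr_eq0; apply/eqP/aA.
have urB : ur \in dirspace B by apply: mem_dirspace_argmin.
have f0 q : 0 <= l q ur by rewrite subr_ge0; apply/argminP.
have fpos q : q \notin B -> 0 < l q ur by move=> qB; rewrite subr_gt0 argmin_lt.
have [q1 q1A q1B] : exists2 q, q \in A & q \notin B.
  apply/fintype.subsetPn/negP => AB.
  have AE : A = B by apply/eqP; rewrite finset.eqEsubset AB.
  by move: dimBA; rewrite AE => /eqP; rewrite ltn_eqF.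
(* The form [h] vanishes on [dirspace A] and is positive on every element of the cone not constant
   on [A]; its level set through [ur] is the slice. *)
pose h n := \sum_(q in A) l q n.
have hD a b : h (a + b) = h a + h b.
  by rewrite /h -big_split; apply: eq_bigr => q _; rewrite lD.
have hZ c a : h (c *: a) = c * h a.
  by rewrite /h mulr_sumr; apply: eq_bigr => q _; rewrite lZ.
have hA a : a \in dirspace A -> h a = 0.
  by move=> aA; rewrite /h big1 // => q qA; apply: lA.
have hpos n q : (forall k, k \in A -> 0 <= l k n) -> q \in A -> 0 < l q n -> 0 < h n.
  move=> n0 qA qn; rewrite /h (bigD1 q) //= ltr_pwDl // sumr_ge0 // => k /andP[kA _].
  exact: n0.
have hur : 0 < h ur by apply: (hpos _ q1) => //; apply: fpos.
have LAB : (dirspace A <= dirspace B)%VS by apply: dirspace_anti.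
pose U := (dirspace A + <[ur]>)%VS.
have dimU : (\dim U <= (\dim (dirspace A)).+1)%N.
  apply: leq_trans (dimv_add_leqif _ _) _.
  by rewrite -(addn1 (\dim _)) leq_add2l dim_vline leq_b1.
have [w0 w0B w0U] : exists2 w, w \in dirspace B & w \notin U.
  apply: contrapT => nw.
  have : (dirspace B <= U)%VS.
    by apply/subvP => w wB; apply/negPn/negP => wU; apply: nw; exists w.
  by move/dimvS; rewrite dimBA ltnNge => /negP[]; rewrite (leq_trans dimU).
(* Correcting [w0] by a multiple of [ur] puts the direction into the kernel of [h], hence along the
   slice. *)
pose w1 := w0 - (h w0 / h ur) *: ur.
have w0E : w0 = w1 + (h w0 / h ur) *: ur by rewrite subrK.
have hw1 : h w1 = 0.
  by rewrite /w1 -scaleNr hD hZ mulNr divfK ?subrr // gt_eqF.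
have w1B : w1 \in dirspace B by rewrite memvB // memvZ.
have w1A : w1 \notin dirspace A.
  apply: contra w0U => w1A; rewrite w0E; apply: memv_add => //.
  by rewrite memvZ // memv_line.
have dec n : n \in dirspace B -> exists a c b,
    a \in dirspace A /\ n = a + c *: ur + b *: w1.
  move=> nB.
  have /eqP E : (U + <[w1]>)%VS == dirspace B.
    rewrite eqEdim; apply/andP; split.
      by rewrite !subv_add LAB -!memvE urB w1B.
    have urA : ur \notin dirspace A.
      by apply/negP => /hA hu; rewrite hu ltxx in hur.
    have dU : \dim U = (\dim (dirspace A) + 1)%N.
      rewrite /U dimv_disjoint_sum ?dim_vline; last first.
        apply/eqP; rewrite -subv0; apply/subvP => z /memv_capP[zA /vlineP[c zE]].
        have : h z = 0 by apply: hA.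
        rewrite zE hZ => /eqP; rewrite mulf_eq0 (gt_eqF hur) orbF => /eqP ->.
        by rewrite scale0r mem0v.
      by have -> : ur != 0 by apply: contra urA => /eqP ->; rewrite mem0v.
    have w1U : w1 \notin U.
      apply: contra w0U => w1U; rewrite w0E; apply: memvD => //.
      by apply: memvZ; apply: subvP (addvSr _ _) _ (memv_line _).
    rewrite dimv_disjoint_sum ?dim_vline; last first.
      apply/eqP; rewrite -subv0; apply/subvP => z /memv_capP[zU /vlineP[c zE]].
      have [c0|c0] := eqVneq c 0; first by rewrite zE c0 scale0r mem0v.
      case/negP: w1U; rewrite -[w1](scalerK c0) -zE; exact: memvZ.
    have -> : w1 != 0 by apply: contra w1A => /eqP ->; rewrite mem0v.
    by rewrite dU dimBA !addn1.
  move: nB; rewrite -E => /memv_addP[z /memv_addP[a aA [y /vlineP[c ->] ->]]].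
  by move=> [y' /vlineP[b ->] ->]; exists a, c, b.
(* The numbers [l q w1] for q in [A] have sum 0 and are not all 0, so both signs occur and the line
   leaves the cone in both directions. *)
have [[qp qpA gqp] [qm qmA gqm]] :
    (exists2 q, q \in A & 0 < l q w1) /\ (exists2 q, q \in A & l q w1 < 0).
  have nz : exists2 q, q \in A & l q w1 != 0.
    apply: contrapT => nz; case/negP: w1A; apply/dirspaceP => i j iA jA.
    have z q : q \in A -> ev q w1 = ev j0 w1.
      move=> qA; apply/eqP; rewrite -subr_eq0; apply/negPn/negP => lq.
      by apply: nz; exists q.
    by rewrite !z.
  have [q qA lq] := nz.
  have sgn (e : 'cV[R]_d) : h e = 0 -> l q e != 0 -> exists2 q, q \in A & l q e < 0.
    move=> he lqe; apply: contrapT => nn.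
    have ge0 k : k \in A -> 0 <= l k e.
      by move=> kA; rewrite leNgt; apply/negP => lk; apply: nn; exists k.
    have qe : 0 < l q e by rewrite lt_neqAle eq_sym lqe ge0.
    by have := hpos _ _ ge0 qA qe; rewrite he ltxx.
  split; last exact: sgn.
  have [k kA] : exists2 k, k \in A & l k (- w1) < 0.
    by apply: sgn; rewrite -scaleN1r ?hZ ?hw1 ?mulr0 // lZ mulN1r oppr_eq0.
  by rewrite -scaleN1r lZ mulN1r oppr_lt0 => lk; exists k.
have lN q : l q (- w1) = - l q w1 by rewrite -scaleN1r lZ mulN1r.
have [v1 [t1 [v1I t10 t1A [r1 [r1A gr1 tr1]] v1E]]] :
  exists v t, [/\ intermediate v, 0 < t,
    forall q, q \in A -> 0 <= l q ur + t * l q w1,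
    (exists q, [/\ q \in A, l q w1 < 0 & l q ur + t * l q w1 = 0]) &
    argmin v = [set q in A | l q ur + t * l q w1 == 0]%SET].
  by apply: exit_facet => //; [exists qm|exists qp].
have [v2 [t2 [v2I t20 t2A [r2 [r2A gr2 tr2]] v2E]]] :
  exists v t, [/\ intermediate v, 0 < t,
    forall q, q \in A -> 0 <= l q ur + t * l q (- w1),
    (exists q, [/\ q \in A, l q (- w1) < 0 & l q ur + t * l q (- w1) = 0]) &
    argmin v = [set q in A | l q ur + t * l q (- w1) == 0]%SET].
  apply: exit_facet => //; first by rewrite memvN.
    by exists qp => //; rewrite -/(l _ _) lN oppr_lt0.
  by exists qm => //; rewrite -/(l _ _) lN oppr_gt0.
exists v1, v2; split.
  apply/eqP => /setP/(_ r1); rewrite v1E v2E.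
  rewrite [X in X = _]finset.in_set [X in _ = X]finset.in_set r1A tr1 eqxx /=.
  move/esym; rewrite lN gt_eqF // -[ltLHS]tr1 ltrD2l mulrN -mulNr ltr_nM2r //.
  by rewrite (lt_trans _ t10) // oppr_lt0.
move=> v; split; last by case=> vE; rewrite /intermediate vE.
case=> Bv vA dv.
have j0v : j0 \in argmin v := fintype.subsetP Bv _ j0B.
have [q2 q2A q2v] : exists2 q, q \in A & q \notin argmin v.
  apply/fintype.subsetPn/negP => AV.
  have AE : argmin v = A by apply/eqP; rewrite finset.eqEsubset vA AV.
  by move: dv; rewrite AE => /n_Sn.
have [q3 q3v q3B] : exists2 q, q \in argmin v & q \notin B.
  apply/fintype.subsetPn/negP => VB.
  have BE : argmin v = B by apply/eqP; rewrite finset.eqEsubset VB Bv.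
  by move: dv; rewrite BE dimBA => -[] /esym /n_Sn.
have vB : v \in dirspace B.
  exact: (subvP (dirspace_anti Bv) _ (mem_dirspace_argmin s v)).
have [a [c [b [aA vE]]]] := dec v vB.
have lv q : q \in A -> l q v = c * l q ur + b * l q w1.
  by move=> qA; rewrite vE 2!lD 2!lZ lA // add0r.
have lv0 q : 0 <= l q v by rewrite subr_ge0; apply/argminP.
have lvE q : (q \in argmin v) = (l q v == 0).
  by rewrite (argminE _ j0v) subr_eq0.
have c0 : 0 < c.
  have : 0 < h v.
    apply: (hpos _ q2) => //.
    by rewrite lt_neqAle lv0 andbT eq_sym -lvE.
  by rewrite vE 2!hD 2!hZ hA // add0r hw1 mulr0 addr0 pmulr_lgt0.
pose t := b / c.
have btc : b = c * t by rewrite /t mulrC divfK // gt_eqF.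
have lvt q : q \in A -> l q v = c * (l q ur + t * l q w1).
  by move=> qA; rewrite lv // btc; ring.
have lt0 q : q \in A -> 0 <= l q ur + t * l q w1.
  by move=> qA; have := lv0 q; rewrite lvt // pmulr_rge0.
have argv : argmin v = [set q in A | l q ur + t * l q w1 == 0]%SET.
  apply/setP => q; rewrite finset.inE lvE; have [qA|qA] := boolP (q \in A).
    by rewrite lvt // mulf_eq0 gt_eqF.
  apply/negbTE; rewrite -lvE; apply: contra qA; exact: (fintype.subsetP vA).
have q3A : q3 \in A := fintype.subsetP vA _ q3v.
have q3t : l q3 ur + t * l q3 w1 = 0.
  by move: q3v; rewrite argv finset.inE => /andP[_ /eqP].
have lq3 := fpos _ q3B.
(* The form of [q3] vanishes at the parameter [t] of [v]. The sign of its slope decides at which end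
   of the segment [v] lies; slope 0 is impossible as the form is positive at [ur]. *)
have [g3|g3|g3] := ltrgt0P (l q3 w1).
- right; rewrite argv; suff -> : t = - t2.
    rewrite v2E; apply/setP => q.
    by rewrite [LHS]finset.in_set [RHS]finset.in_set lN mulrN mulNr.
  move: (t2A _ q3A) tr2 gr2; rewrite !lN oppr_lt0 !mulrN -!mulNr => le tr2 gr2.
  apply: le_anti; rewrite (root_le q3t le g3) /=.
  exact: root_le tr2 (lt0 _ r2A) gr2.
- left; rewrite argv; suff -> : t = t1 by rewrite v1E.
  apply: le_anti; rewrite (root_ge tr1 (lt0 _ r1A) gr1) /=.
  exact: root_ge q3t (t1A _ q3A) g3.
- by move: q3t; rewrite g3 mulr0 addr0 => lq30; rewrite lq30 ltxx in lq3.
Qed.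

End Diamond.

(** * Reflexive polytopes *)

Section LatticePairing.
Variables (R : realType) (d : nat).
Implicit Types (x y : 'rV[int]_d) (n : 'cV[int]_d) (a : 'cV['F_2]_d).

Definition ipair x n : int := (x *m n) 0 0.
Definition fpair x a : 'F_2 := (lat_mod2 x *m a) 0 0.

Lemma pairing_lat x n :
  pairing (lat_real R x) (lat_real R n) = (ipair x n)%:~R.
Proof. by rewrite /pairing /lat_real -map_mxM mxE. Qed.

Lemma fpair_lat x n : fpair x (lat_mod2 n) = (ipair x n)%:~R.
Proof. by rewrite /fpair /lat_mod2 -map_mxM mxE. Qed.

Lemma ipairDl x y n : ipair (x + y) n = ipair x n + ipair y n.
Proof. by rewrite /ipair mulmxDl mxE. Qed.

Lemma ipairZl k x n : ipair (k *: x) n = k * ipair x n.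
Proof. by rewrite /ipair -scalemxAl mxE. Qed.

Lemma fpairDr x a b : fpair x (a + b) = fpair x a + fpair x b.
Proof. by rewrite /fpair mulmxDr mxE. Qed.

End LatticePairing.

Lemma lat_real_inj (R : realType) m n : injective (@lat_real R m n).
Proof.
move=> u v /matrixP uv; apply/matrixP => i j.
by have := uv i j; rewrite !mxE => /intr_inj.
Qed.

Lemma F2_intr_eq0 (k : int) : (k%:~R == 0 :> 'F_2) -> exists l : int, k = 2 * l.
Proof.
have nE (m : nat) : (m%:R == 0 :> 'F_2) -> exists l, m = l.*2.
  move=> m0; exists m./2; apply/eqP.
  rewrite -{1}(odd_double_half m) -[X in _ == X]add0n eqn_add2r.
  by move/eqP: m0 => /(congr1 (@nat_of_ord _)); rewrite val_Fp_nat //= modn2 => ->.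
case: k => m.
  by rewrite -pmulrn => /nE[l ->]; exists l; lia.
rewrite NegzE mulrNz oppr_eq0 -pmulrn => /nE[l lE]; exists (- l%:Z); lia.
Qed.

Definition F2_lift (a : 'F_2) : int := (a : nat)%:Z.

Lemma F2_liftK a : (F2_lift a)%:~R = a.
Proof. by rewrite /F2_lift -pmulrn natr_Zp. Qed.

Lemma lat_mod2_eq0 m n (x : 'M[int]_(m, n)) :
  lat_mod2 x = 0 -> exists y, x = 2 *: y.
Proof.
move=> /matrixP x0.
have h i j : {l | x i j = 2 * l}.
  by apply/cid/F2_intr_eq0; have := x0 i j; rewrite !mxE => ->.
exists (\matrix_(i, j) sval (h i j)); apply/matrixP => i j.
by rewrite !mxE; case: (h i j).
Qed.

(** * Vectors independent mod 2 *)

Section LatticeLift.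
Variables (d : nat) (zs : seq 'rV[int]_d).
Hypothesis zs_free : free (map (@lat_mod2 1 d) zs).

Let k := size zs.
Let B : 'M[int]_(k, d) := \matrix_(i < k) zs`_i.
Let Bmod : 'M['F_2]_(k, d) := map_mx intr B.

Let Bmod_free : row_free Bmod.
Proof.
apply: inj_row_free => w w0.
have /freeP fr : free (map_tuple (@lat_mod2 1 d) (in_tuple zs)) := zs_free.
apply/rowP => i; rewrite mxE; apply: fr.
rewrite -[RHS]w0 mulmx_sum_row; apply: eq_bigr => j _; congr (_ *: _).
by rewrite (nth_map 0) //; apply/rowP => l; rewrite !mxE.
Qed.

Lemma fpair_row v (i : 'I_k) a : zs`_i = v -> fpair v a = (Bmod *m a) i 0.
Proof.
by move=> <-; rewrite /fpair !mxE; apply: eq_bigr => j _; rewrite !mxE.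
Qed.

Lemma fpair_prescribed (t : 'rV[int]_d -> 'F_2) :
  exists a, forall v, v \in zs -> fpair v a = t v.
Proof.
have /row_freeP[C BC] := Bmod_free.
exists (C *m \col_i t zs`_i) => v vzs.
have iP : (index v zs < k)%N by rewrite index_mem.
rewrite (@fpair_row v (Ordinal iP)) ?nth_index // mulmxA BC mul1mx mxE /=.
by rewrite nth_index.
Qed.

(* With C a lift of a right inverse of Bmod, D := B C has odd determinant, so
   det(D) a - C adj(D) B a lifts a and is killed by B. *)
Lemma lift_orthogonal (a : 'cV['F_2]_d) :
    (forall v, v \in zs -> fpair v a = 0) ->
  exists2 n : 'cV[int]_d, lat_mod2 n = a & forall v, v \in zs -> ipair v n = 0.
Proof.
move=> a0; have /row_freeP[C BC] := Bmod_free.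
pose Cz := map_mx F2_lift C; pose az := map_mx F2_lift a.
have CzE : map_mx intr Cz = C :> 'M['F_2]__.
  by apply/matrixP => i j; rewrite !mxE F2_liftK.
have azE : map_mx intr az = a :> 'M['F_2]__.
  by apply/matrixP => i j; rewrite !mxE F2_liftK.
pose D := B *m Cz.
have DE : map_mx intr D = 1%:M :> 'M['F_2]__ by rewrite map_mxM CzE.
have detD : (\det D)%:~R = 1 :> 'F_2 by rewrite -det_map_mx DE det1.
have Ba : Bmod *m a = 0.
  apply/colP => i; rewrite -(@fpair_row zs`_i) // a0 ?mxE //.
  exact: mem_nth.
exists (\det D *: az - Cz *m (\adj D *m (B *m az))).
  rewrite /lat_mod2 map_mxB map_mxZ /= detD scale1r azE !map_mxM azE.
  by rewrite -/Bmod Ba !mulmx0 subr0.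
move=> v vzs; have iP : (index v zs < k)%N by rewrite index_mem.
rewrite /ipair.
have -> : v = row (Ordinal iP) B by rewrite rowK /= nth_index.
rewrite -row_mul mulmxBr -scalemxAr !mulmxA -/D mul_mx_adj.
by rewrite -mulmxA mul_scalar_mx subrr !mxE.
Qed.

End LatticeLift.

(** Applied to the transpose of a functional u <> 0, it gives a point of [P] where u is negative. *)
Lemma interior0_opp (R : realType) (d : nat) (P : set 'rV[R]_d) :
  (P^° 0)%classic -> forall x, exists2 e : R, 0 < e & P (- e *: x).
Proof.
move=> /nbhs_ballP[e /= e0 eP] x.
pose S := \sum_j `|x 0 j|; have S0 : 0 <= S by apply: sumr_ge0.
exists (e / (1 + S)); first by rewrite divr_gt0 // ltr_pwDl.
apply: eP; split=> // i j; rewrite !mxE ord1 /ball /= sub0r normrN normrM normrN.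
rewrite (@ger0_norm _ (e / _)) ?divr_ge0 ?addr_ge0 ?(ltW e0) //.
rewrite mulrAC ltr_pdivrMr ?ltr_pwDl // ltr_pM2l //.
have : `|x 0 j| <= S by rewrite /S (bigD1 j) //= lerDl sumr_ge0.
lra.
Qed.

Lemma pairing_trmx_gt0 (R : realType) (d : nat) (u : 'cV[R]_d) :
  u != 0 -> 0 < pairing u^T u.
Proof.
move=> u0; have sq i : 0 <= u^T 0 i * u i 0 by rewrite mxE -expr2 sqr_ge0.
rewrite lt_neqAle /pairing mxE sumr_ge0 ?andbT // eq_sym.
apply: contra u0 => /eqP sum0; apply/eqP/colP => i; rewrite [RHS]mxE.
have := @psumr_eq0P _ _ xpredT _ (fun i _ => sq i) sum0 i isT.
by rewrite mxE => /eqP; rewrite mulf_eq0 orbb => /eqP.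
Qed.

Lemma primitive_neq0 m n (v : 'M[int]_(m, n)) : primitive v -> v != 0.
Proof.
move=> vp; apply/eqP => v0.
by have := vp 0 0; rewrite v0 scaler0 => /(_ erefl).
Qed.

Lemma sum1_neq0 (R : nzRingType) (I : finType) (a : I -> R) :
  \sum_i a i = 1 -> exists i, a i != 0.
Proof.
move=> a1; apply: contrapT => na; have /eqP := oner_neq0 R; apply.
by rewrite -a1 big1 // => i _; apply/eqP/negPn/negP => ai; apply: na; exists i.
Qed.

(** * Faces of a reflexive polytope *)

Section ReflexivePolytope.
Variables (R : realType) (d : nat) (s' : seq 'rV[int]_d).
Let s := map (@lat_real R 1 d) s'.
Let P := conv_hull s.
Hypotheses (P0 : (P^° 0)%classic) (Ppolar : lattice_polytope (polar P)).
Local Notation I := 'I_(size s).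
Implicit Types (i j : I) (u w : 'cV[R]_d) (n : 'cV[int]_d) (a : 'cV['F_2]_d).

Definition gen i : 'rV[int]_d := s'`_i.

Lemma nth_gen i : s`_i = lat_real R (gen i).
Proof. by rewrite /s (nth_map 0) // -(size_map (@lat_real R 1 d)). Qed.

Lemma ev_lat i n : ev i (lat_real R n) = (ipair (gen i) n)%:~R.
Proof. by rewrite /ev nth_gen pairing_lat. Qed.

Lemma size_gt0 : (0 < size s)%N.
Proof.
have [a [_ a1 _]] := interior_subset P0.
rewrite lt0n; apply/eqP => s0.
have : \sum_i a i = 0.
  apply: big1 => i _; have := leq_ltn_trans (leq0n i) (ltn_ord i).
  by rewrite lt0n => /eqP.
by rewrite a1 => /eqP; rewrite oner_eq0.
Qed.

Lemma argmin_neqT_lt0 i u : i \in argmin s u -> argmin s u != finset.setT ->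
  ev i u < 0.
Proof.
move=> iu uT; have u0 : u != 0.
  apply: contra uT => /eqP ->; apply/eqP/setP => j; rewrite finset.in_setT.
  by apply/argminP => k; rewrite /ev !linear0.
have [e e0 eP] := interior0_opp P0 u^T.
have := conv_hull_ge (argminP _ _ iu) eP.
rewrite pairingZl mulNr => /le_lt_trans; apply.
by rewrite oppr_lt0 mulr_gt0 // pairing_trmx_gt0.
Qed.

Lemma dirspace_setT : dirspace (finset.setT : {set I}) = 0%VS.
Proof.
apply/eqP; rewrite -subv0; apply/subvP => u /dirspaceP uT; rewrite memv0.
apply/negPn/negP => u0.
have [e e0 eP] := interior0_opp P0 u^T.
have [i0 _] := argmin_neq0 u size_gt0.
have cst x : P x -> pairing x u = ev i0 u.
  move=> [a [_ a1 ->]]; rewrite pairing_conv -[RHS]mul1r -a1 mulr_suml.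
  by apply: eq_bigr => i _; rewrite (uT i i0) ?finset.in_setT.
have := cst _ eP; rewrite -(cst 0 (interior_subset P0)) pairing0l pairingZl.
move/eqP; rewrite mulf_eq0 oppr_eq0 (gt_eqF e0) /=.
by rewrite gt_eqF // pairing_trmx_gt0.
Qed.

(* The facets of a reflexive polytope are at lattice distance 1 from 0. *)
Lemma height_function u : argmin s u != finset.setT ->
  exists n, argmin s u \subset argmin s (lat_real R n) /\
    forall i, i \in argmin s u -> ipair (gen i) n = -1.
Proof.
move=> uT; have [i0 i0u] := argmin_neq0 u size_gt0.
(* Scaled to have minimum -1 on [P], the functional [u'] lies in the polar polytope. *)
have m0 := argmin_neqT_lt0 i0u uT; pose u' := (- ev i0 u)^-1 *: u.
have u'ge i : -1 <= ev i u'.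
  rewrite evZ mulrC ler_pdivlMr ?oppr_gt0 // mulN1r opprK.
  exact: (argminP _ _ i0u).
have u'E i : i \in argmin s u -> ev i u' = -1.
  move=> iu; rewrite evZ (argmin_eq iu i0u) invrN mulNr mulVf //.
  by rewrite lt_eqF.
have [t tE] := Ppolar; set tr := map _ _ in tE.
have : polar P u' by move=> x; apply: conv_hull_ge.
rewrite tE => -[b [b0 b1 u'b]].
have trge i (k : 'I_(size tr)) : -1 <= ev i tr`_k.
  have : polar P tr`_k by rewrite tE; apply: conv_hull_nth.
  by apply; apply: conv_hull_nth.
(* On the face [u'] attains the bound -1 common to all points of the polar, so each lattice
   generator of the polar with nonzero weight in [u'] attains it too. *)
have [k bk] := sum1_neq0 b1.
have trE i : i \in argmin s u -> ev i tr`_k = -1.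
  move=> iu; have sum0 : \sum_k b k * (ev i tr`_k + 1) = 0.
    under eq_bigr do rewrite mulrDr mulr1.
    rewrite big_split /= b1 -[X in _ + X]opprK -(u'E i iu) u'b.
    rewrite /ev linear_sum; under [X in _ - X]eq_bigr do rewrite linearZ /=.
    by rewrite subrr.
  have ge0 l : true -> 0 <= b l * (ev i tr`_l + 1).
    by move=> _; rewrite mulr_ge0 // -[1]opprK subr_ge0.
  have /eqP := @psumr_eq0P _ _ xpredT _ ge0 sum0 k isT.
  by rewrite mulf_eq0 (negPf bk) addr_eq0 => /eqP.
have trk : tr`_k = lat_real R t`_k.
  by rewrite /tr (nth_map 0) // -(size_map (@lat_real R d 1)).
exists t`_k; rewrite -trk; split=> [|i iu].
  by apply/fintype.subsetP => i iu; apply/argminP => j; rewrite trE.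
by apply: (@intr_inj R); rewrite -ev_lat -trk trE.
Qed.

(** As generators may repeat, a vertex is represented by the least of its indices, which makes [gen]
    injective here. *)
Definition vertices : {set I} := [set i | `[< exists x, forall j, j != i ->
  ev i x < ev j x \/ (s`_j = s`_i /\ (i < j)%N) >]]%SET.

Lemma verticesP i : reflect (exists x, forall j, j != i ->
  ev i x < ev j x \/ (s`_j = s`_i /\ (i < j)%N)) (i \in vertices).
Proof. by rewrite finset.inE; apply: asboolP. Qed.

Lemma gen_vertices_inj : {in vertices &, injective gen}.
Proof.
move=> i j /verticesP[x xi] /verticesP[y yj] ij; apply/eqP/negPn/negP => nij.
have sij : s`_i = s`_j by rewrite !nth_gen ij.
have [|[_ lij]] := xi j (contra_neq esym nij); first by rewrite /ev sij ltxx.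
have [|[_ lji]] := yj i nij; first by rewrite /ev sij ltxx.
by have := ltn_trans lij lji; rewrite ltnn.
Qed.

Section ProperFace.
Variable u : 'cV[R]_d.
Hypothesis uT : argmin s u != finset.setT.
Let C := cone_over (face_of s u).

Lemma face_fan_cone : face_fan P C.
Proof.
right; exists (face_of s u); split=> //; first exact: is_face_of.
  move=> E; case/negP: uT; apply/eqP/setP => i; rewrite finset.in_setT.
  by apply/face_of_nth; rewrite E; apply: conv_hull_nth.
by have [i iu] := argmin_neq0 u size_gt0; exists s`_i; apply/face_of_nth.
Qed.

Lemma cone_nth i : i \in argmin s u -> C s`_i.
Proof. by move=> iu; exists 1, s`_i; rewrite ?scale1r //; apply/face_of_nth. Qed.

(** The ray contains a generator of the face. That generator has height -1 and [v] has integral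
    height, so [v] is an integral multiple of it, and primitivity makes the two equal. *)
Lemma ray_generator_vertex v : ray_generator C v ->
  exists i, [/\ i \in argmin s u, i \in vertices & gen i = v].
Proof.
move=> [r [[[f rE] dr] rv vp]].
have [w fw] := scalar_pairing f.
have [n [_ nE]] := height_function uT.
pose h (x : 'rV[R]_d) := pairing x (lat_real R n).
have Fh y : face_of s u y -> h y = -1.
  move=> yF; have [[a [a0 a1 yE]] _] := yF; rewrite yE in yF.
  rewrite /h yE pairing_conv -[RHS]mul1r -[X in _ = X * _]a1 mulr_suml; apply: eq_bigr => i _.
  have [->|ai] := eqVneq (a i) 0; first by rewrite !mul0r.
  by rewrite ev_lat nE ?(face_of_supp a0 a1 yF) // rmorphN1.
have C0 : C 0.
  have [i iu] := argmin_neq0 u size_gt0.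
  by exists 0, s`_i; [apply/face_of_nth|rewrite scale0r].
(* A minimum attained on a cone is 0: compare [v] with 0 and with 2 v. *)
have Cge x : C x -> 0 <= pairing x w.
  move: rv; rewrite rE => -[Cv vmin] Cx.
  have v0 := vmin _ C0; rewrite !fw pairing0l in v0.
  have [t [y yF [t0 vE]]] := Cv.
  have C2 : C (2 *: lat_real R v).
    by exists (2 * t), y => //; rewrite mulr_ge0 // vE scalerA.
  have := vmin _ C2; rewrite !fw pairingZl => v2.
  by have := vmin _ Cx; rewrite !fw; lra.
have rP x : r x <-> C x /\ pairing x w = 0.
  rewrite rE; split=> [[Cx xmin]|[Cx x0]]; split=> //.
    have := xmin _ C0; rewrite !fw pairing0l => le.
    by apply/eqP; rewrite eq_le le Cge.
  by move=> y Cy; rewrite !fw x0 Cge.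
have [Cv vw] := (rP _).1 rv.
have v0 : lat_real R v != 0.
  apply: contra (primitive_neq0 vp) => /eqP v0; apply/eqP/(@lat_real_inj R).
  by rewrite v0 /lat_real map_mx0.
have line x : r x -> exists c, x = c *: lat_real R v.
  move=> rx; apply/vlineP.
  have /eqP -> : <[lat_real R v]>%VS == linspan r.
    rewrite eqEdim dim_vline v0 /= -/(Defs.dim_span r) dr leqnn andbT -memvE.
    exact: mem_linspan.
  exact: mem_linspan.
have [t [y yF [t0 vE]]] := Cv.
have [[a [a0 a1 yE]] _] := yF.
have tpos : 0 < t.
  rewrite lt_neqAle t0 andbT eq_sym; apply: contra v0 => /eqP t00.
  by rewrite vE t00 scale0r.
have yw : pairing y w = 0.
  move: vw; rewrite vE pairingZl => /eqP; rewrite mulf_eq0 (gt_eqF tpos).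
  by move/eqP.
have [i0 ai0] := sum1_neq0 a1.
have yF' := yF; rewrite yE in yF'.
have i0u : i0 \in argmin s u := face_of_supp a0 a1 yF' ai0.
have i0w : ev i0 w = 0.
  have ge0 l : true -> 0 <= a l * ev l w.
    move=> _; have [->|al] := eqVneq (a l) 0; first by rewrite mul0r.
    by rewrite mulr_ge0 // Cge //; apply/cone_nth/(face_of_supp a0 a1 yF').
  have sum0 : \sum_l a l * ev l w = 0 by rewrite -pairing_conv -yE.
  have /eqP := @psumr_eq0P _ _ xpredT _ ge0 sum0 i0 isT.
  by rewrite mulf_eq0 (negPf ai0) => /eqP.
have hgen i : i \in argmin s u -> h s`_i = -1.
  by move=> iu; rewrite /h -/(ev i _) ev_lat nE // rmorphN1.
have genE i : i \in argmin s u -> ev i w = 0 -> s`_i = t^-1 *: lat_real R v.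
  move=> iu iw; have [c cE] : exists c, s`_i = c *: lat_real R v.
    by apply/line/rP; split=> //; apply: cone_nth.
  rewrite cE; congr (_ *: _); have := hgen i iu.
  rewrite cE vE scalerA /h pairingZl -/(h y) Fh // mulrN1 => /eqP.
  rewrite eqr_opp => /eqP ct.
  by rewrite -[LHS]mulr1 -(divff (lt0r_neq0 tpos)) mulrA ct mul1r.
have vt : lat_real R v = t *: s`_i0.
  by rewrite (genE i0 i0u i0w) scalerA divff ?scale1r ?gt_eqF.
have tint : t = (- ipair v n)%:~R.
  rewrite rmorphN /= -pairing_lat vt -/(h _) /h pairingZl -/(h _) hgen //.
  by rewrite mulrN1 opprK.
have t1 : t = 1.
  have : `|- ipair v n|%N = 1%N.
    apply: (vp _ (gen i0)); apply: (@lat_real_inj R).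
    by rewrite vt nth_gen /lat_real map_mxZ /= -tint.
  have : 0 < - ipair v n by rewrite -(ltr0z R) -tint.
  rewrite tint; case: (- ipair v n) => // m _ /= ->.
  by [].
have vs : lat_real R v \in s by rewrite vt t1 scale1r mem_nth.
(* [index] returns the first occurrence, the one that [vertices] admits. *)
pose i : I := Ordinal (etrans (index_mem _ _) vs : (index (lat_real R v) s < size s)%N).
have si : s`_i = lat_real R v by rewrite /= nth_index.
have Ei (k : I) : (s`_k == lat_real R v) = (k \in argmin s u) && (ev k w == 0).
  apply/eqP/andP => [sk|[ku /eqP kw]]; last first.
    by rewrite (genE k ku kw) t1 invr1 scale1r.
  have k0 : s`_k = s`_i0 by rewrite sk vt t1 scale1r.
  split; last by rewrite /ev k0 -/(ev i0 w) i0w.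
  by apply/face_of_nth; rewrite k0; apply/face_of_nth.
have /andP[iu /eqP iw] : (i \in argmin s u) && (ev i w == 0) by rewrite -Ei si.
exists i; split=> //; last by apply: (@lat_real_inj R); rewrite -nth_gen.
(* The functional [l *: u + w] first selects the face by [u], then the ray inside it by [w]. *)
have [l l0 lP] := @perturbation R _ (fun k : I => ev k u - ev i u)
  (fun k : I => ev k w - ev i w).
apply/verticesP; exists (l *: u + w) => j ji.
rewrite -subr_gt0 !evD !evZ opprD addrACA -mulrBr.
have [ju|ju] := boolP (j \in argmin s u); last first.
  by left; apply: lP; rewrite subr_gt0 argmin_lt.
rewrite (argmin_eq ju iu) subrr mulr0 add0r iw subr0.
have [jw|jw] := eqVneq (ev j w) 0; last first.
  by left; rewrite lt_neqAle eq_sym jw Cge //; apply: cone_nth.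
have sj : s`_j = lat_real R v by apply/eqP; rewrite Ei ju jw /=.
right; rewrite sj si; split=> //.
rewrite ltn_neqAle eq_sym (_ : (j == i :> nat) = (j == i)) // ji /=.
rewrite leqNgt; apply/negP => /(before_find 0) /=.
by rewrite sj eqxx.
Qed.

Lemma vertex_ray_generator i : i \in argmin s u -> i \in vertices ->
  ray_generator C (gen i).
Proof.
move=> iu /verticesP[x xi].
have [n [_ nE]] := height_function uT.
(* As n is -1 on the face, [w] is there the exposing functional [x] minus its minimum, and its zero
   set cuts the ray out of the cone. *)
pose w := x + ev i x *: lat_real R n.
have wE k : k \in argmin s u -> ev k w = ev k x - ev i x.
  by move=> ku; rewrite /w evD evZ ev_lat nE // mulrN1.
have wge k : k \in argmin s u -> 0 <= ev k w.
  move=> ku; rewrite wE // subr_ge0; have [->//|ki] := eqVneq k i.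
  by have [/ltW//|[E _]] := xi k ki; rewrite /ev E.
have weq k : k \in argmin s u -> ev k w = 0 -> s`_k = s`_i.
  move=> ku /eqP; rewrite wE // subr_eq0 => /eqP kx.
  have [->//|ki] := eqVneq k i.
  by have [|[]//] := xi k ki; rewrite kx ltxx.
have wi : ev i w = 0 by rewrite wE ?subrr.
have Fw y : face_of s u y -> 0 <= pairing y w.
  move=> yF; have [[a [a0 a1 yE]] _] := yF; rewrite yE in yF *.
  rewrite pairing_conv sumr_ge0 // => k _.
  have [->|ak] := eqVneq (a k) 0; first by rewrite mul0r.
  by rewrite mulr_ge0 // wge // (face_of_supp a0 a1 yF).
have Fw0 y : face_of s u y -> pairing y w = 0 -> y = s`_i.
  move=> yF; have [[a [a0 a1 yE]] _] := yF; rewrite yE in yF *.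
  rewrite pairing_conv => sum0.
  have ge0 l : true -> 0 <= a l * ev l w.
    move=> _; have [->|al] := eqVneq (a l) 0; first by rewrite mul0r.
    by rewrite mulr_ge0 // wge // (face_of_supp a0 a1 yF).
  rewrite -[RHS]scale1r -a1 scaler_suml; apply: eq_bigr => k _.
  have [->|ak] := eqVneq (a k) 0; first by rewrite !scale0r.
  have /eqP := @psumr_eq0P _ _ xpredT _ ge0 sum0 k isT.
  rewrite mulf_eq0 (negPf ak) => /eqP kw.
  by rewrite (weq k) // (face_of_supp a0 a1 yF).
have Cw y : C y -> 0 <= pairing y w.
  by move=> [t [z zF [t0 ->]]]; rewrite pairingZl mulr_ge0 // Fw.
pose r : set 'rV[R]_d :=
  [set y | C y /\ forall z, C z -> pairing y w <= pairing z w]%classic.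
have ri : r s`_i.
  by split=> [|z /Cw]; [exact: cone_nth|rewrite -/(ev i w) wi].
have si0 : s`_i != 0.
  apply/eqP => si0; have := ev_lat i n; rewrite nE // /ev si0 pairing0l => /eqP.
  by rewrite eq_sym intr_eq0.
exists r; split; last 1 first.
(* A factor of [gen i] divides its height -1. *)
- move=> k z giE; have := nE i iu; rewrite giE ipairZl => kz.
  have : (`|k| * `|ipair z n|)%N = 1%N by rewrite -abszM kz.
  by move/eqP; rewrite muln_eq1 => /andP[/eqP].
- split.
    have [f fw] := pairing_scalar w; exists f.
    by apply/seteqP; split=> y [Cy ymin]; split=> // z /ymin; rewrite !fw.
  rewrite /Defs.dim_span; suff -> : linspan r = <[s`_i]>%VS by rewrite dim_vline si0.
  apply/eqP; rewrite eqEsubv -memvE mem_linspan // andbT.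
  apply: linspan_sub => y [[t [z zF [t0 ->]]] ymin].
  have := ymin _ (cone_nth iu); rewrite -/(ev i w) wi pairingZl => tz.
  have [->|tn0] := eqVneq t 0; first by rewrite scale0r mem0v.
  have z0 : pairing z w = 0.
    apply/eqP; rewrite eq_le Fw // andbT.
    by rewrite -(@pmulr_rle0 _ t) // lt_neqAle eq_sym tn0.
  by rewrite (Fw0 z zF z0) memvZ // memv_line.
- by rewrite -nth_gen.
Qed.

Hypothesis C_regular : Z2_regular C.

Lemma regular_vertices : exists zs : seq 'rV[int]_d,
  [/\ free (map (@lat_mod2 1 d) zs),
      span_mod2 C = <<map (@lat_mod2 1 d) zs>>%VS,
      forall v, v \in zs -> lat_real R v \in linspan C,
      forall v, v \in zs ->
        exists i, [/\ i \in argmin s u, i \in vertices & gen i = v] &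
      forall i, i \in argmin s u -> i \in vertices -> gen i \in zs].
Proof.
have [zs [_ zsP zsB]] := C_regular; exists zs; split=> [||v /zsP|v /zsP|].
- exact: basis_free zsB.
- exact/esym/span_basis.
- by move=> [r [[[f rE] _] rv _]]; apply: mem_linspan; move: rv; rewrite rE => -[].
- exact: ray_generator_vertex.
- by move=> i iu iv; apply/zsP/vertex_ray_generator.
Qed.

Lemma fpair_vertices (t : I -> 'F_2) :
  exists a, forall i, i \in argmin s u -> i \in vertices -> fpair (gen i) a = t i.
Proof.
have [zs [zsF _ _ _ zsV]] := regular_vertices.
pose t' (v : 'rV[int]_d) :=
  if [pick i | (i \in vertices) && (gen i == v)] is Some i then t i else 0.
have [a aP] := fpair_prescribed zsF t'.
exists a => i iu iv; rewrite aP ?zsV // /t'; case: pickP => [j /andP[jv /eqP]|].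
  by move/(gen_vertices_inj jv iv) => ->.
by move/(_ i); rewrite iv eqxx.
Qed.

(* Modulo the generators, every lattice point of the span is divisible by 2,
   so the pairing with n is divisible by every power of 2. *)
Lemma orthogonal_descent (zs : seq 'rV[int]_d) n :
    span_mod2 C = <<map (@lat_mod2 1 d) zs>>%VS ->
    (forall v, v \in zs -> lat_real R v \in linspan C) ->
    (forall v, v \in zs -> ipair v n = 0) ->
  forall x, lat_real R x \in linspan C -> ipair x n = 0.
Proof.
move=> spanE zsC zsn x; have [m] := ubnP `|ipair x n|%N.
elim: m x => // m IH x xm xC.
have : lat_mod2 x \in span_mod2 C by apply/mem_span_mod2; exists x.
rewrite spanE => /(@coord_span _ _ _ (map_tuple (@lat_mod2 1 d) (in_tuple zs))).
set c := coord _ => xE.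
pose y : 'rV[int]_d := \sum_(i < size zs) F2_lift (c i (lat_mod2 x)) *: zs`_i.
have yC : lat_real R y \in linspan C.
  rewrite /y /lat_real raddf_sum; apply: memv_suml => i _.
  by rewrite /= map_mxZ /=; apply/memvZ/zsC/mem_nth.
have yn : ipair y n = 0.
  rewrite /ipair mulmx_suml summxE big1 // => i _.
  by rewrite -scalemxAl mxE -/(ipair _ _) zsn ?mulr0 // mem_nth.
have : lat_mod2 (x - y) = 0.
  rewrite /lat_mod2 map_mxB -!/(lat_mod2 _) {1}xE; apply/eqP; rewrite subr_eq0.
  apply/eqP; rewrite /y /lat_mod2 raddf_sum; apply: eq_bigr => i _ /=.
  by rewrite map_mxZ /= F2_liftK (nth_map 0).
move/lat_mod2_eq0 => [x' xyE].
have xn : ipair x n = 2 * ipair x' n.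
  by rewrite -ipairZl -xyE -{1}(subrK y x) (ipairDl (x - y)) yn addr0.
have x'C : lat_real R x' \in linspan C.
  have -> : lat_real R x' = 2^-1 *: (lat_real R x - lat_real R y).
    rewrite /lat_real -map_mxB xyE map_mxZ /= scalerA mulVf ?scale1r //.
    by rewrite pnatr_eq0.
  by apply/memvZ/memvB.
have [x'n|x'n] := eqVneq (ipair x' n) 0; first by rewrite xn x'n mulr0.
by rewrite xn IH ?mulr0 //; move: xm; rewrite xn abszM; lia.
Qed.

(** This identifies the dual of N(sigma). For the converse, a vector orthogonal mod 2 to the
    vertices lifts to an integral one orthogonal to them; [orthogonal_descent] makes it orthogonal
    to the whole face, hence a point of the span. *)
Lemma mem_span_mod2_ncone a : reflect
  (forall i j, i \in argmin s u -> i \in vertices ->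
     j \in argmin s u -> j \in vertices -> fpair (gen i) a = fpair (gen j) a)
  (a \in span_mod2 (ncone (argmin s u))).
Proof.
rewrite /span_mod2; apply: (iffP (mem_span_mod2 _ _)).
  move=> [n nu ->] i j iu _ ju _; rewrite !fpair_lat; congr (_%:~R).
  apply: (@intr_inj R); rewrite -!ev_lat.
  by move: nu; rewrite (linspan_ncone size_gt0) => /dirspaceP; apply.
move=> aP; have [h [hu hE]] := height_function uT.
have [zs [zsF spanE zsC zsV _]] := regular_vertices.
pose e : 'F_2 := if [pick i | (i \in argmin s u) && (i \in vertices)] is Some i
  then fpair (gen i) a else 0.
have eP i : i \in argmin s u -> i \in vertices -> fpair (gen i) a = e.
  move=> iu iv; rewrite /e; case: pickP => [j /andP[ju jv]|]; first exact: aP.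
  by move/(_ i); rewrite iu iv.
have hC : lat_real R h \in linspan (ncone (argmin s u)).
  exact: mem_linspan.
have lift0 (b : 'cV['F_2]_d) : (forall v, v \in zs -> fpair v b = 0) ->
    exists2 n, lat_real R n \in linspan (ncone (argmin s u)) & b = lat_mod2 n.
  move=> b0; have [n nb n0] := lift_orthogonal zsF b0; exists n => //.
  rewrite (linspan_ncone size_gt0); apply/dirspaceP => i j iu ju.
  have z k : k \in argmin s u -> ipair (gen k) n = 0.
    move=> ku; apply: (orthogonal_descent spanE zsC n0).
    by rewrite -nth_gen; apply/mem_linspan/cone_nth.
  by rewrite !ev_lat !z.
case: (F2P e) => e0.
  by apply: lift0 => v /zsV[i [iu iv <-]]; rewrite eP.
(* The height function lies in the cone and is -1 = 1 mod 2 on the face, so adding it reduces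
   constant value 1 to constant value 0. *)
have [|n nC nE] := lift0 (a + lat_mod2 h).
  move=> v /zsV[i [iu iv <-]]; rewrite fpairDr eP // e0 fpair_lat hE //.
  by rewrite mulrNz subrr.
exists (n - h).
  by rewrite /lat_real map_mxB -!/(lat_real _ _) memvB.
by rewrite /lat_mod2 map_mxB -!/(lat_mod2 _) -nE addrK.
Qed.

End ProperFace.
End ReflexivePolytope.

(** * The toric complex *)

Lemma galg_push_eq (K : fieldType) (gT hT : finGroupType) (f g : gT -> hT) x :
  f =1 g -> @galg_push K gT hT f x = galg_push g x.
Proof.
move=> fg; apply/ffunP => h; rewrite !ffunE.
by apply: eq_bigl => k; rewrite fg.
Qed.

Lemma galg_push_comp (K : fieldType) (gT hT kT : finGroupType)
    (f : gT -> hT) (g : hT -> kT) x :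
  galg_push g (galg_push f x) = @galg_push K gT kT (g \o f) x.
Proof.
rewrite (galg_sum_delta x) !linear_sum; apply: eq_bigr => h _ /=.
by rewrite !linearZ /= !galg_push_delta.
Qed.

Lemma galg_mulr2n_eq0 (gT : finGroupType) (x : galg 'F_2 gT) : x *+ 2 = 0.
Proof.
rewrite -scaler_nat (_ : 2%:R = 0) ?scale0r //; exact: val_inj.
Qed.

Section ToricChains.
Variables (R : realType) (d : nat) (Sigma : set (set 'cV[R]_d)).
Implicit Types (sigma tau rho : cone Sigma) (c : chain Sigma).

Canonical N_sub_group sigma := Group (N_sub_group_set sigma).

Lemma N_sub_sub sigma tau : is_facet sigma tau -> N_sub sigma \subset N_sub tau.
Proof.
case=> [[f fE] _]; apply/fintype.subsetP => a; rewrite !finset.inE.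
move=> /mem_span_mod2[v vs ->]; apply/mem_span_mod2; exists v => //.
apply: (subvP _ _ vs); apply: linspan_sub => x; rewrite fE => -[xt _].
exact: mem_linspan.
Qed.

Section Projection.
Variables sigma tau : cone Sigma.
Hypothesis st : N_sub sigma \subset N_sub tau.

Lemma N_proj_coset a :
  N_proj tau (coset (N_sub sigma) a) = coset (N_sub tau) a.
Proof.
apply/esym/eqP; rewrite /N_proj (coset_eq (N_sub_group tau)).
exact: (fintype.subsetP st _ (repr_coset (N_sub_group sigma) a)).
Qed.

Lemma N_projM : {morph N_proj tau : g h / (g * h)%g : N_quot sigma >-> (g * h)%g}.
Proof.
move=> g h; rewrite -(coset_reprK g) -(coset_reprK h).
rewrite -(cosetD (N_sub_group sigma)) !N_proj_coset.
exact: (cosetD (N_sub_group tau)).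
Qed.

Lemma N_proj_surj (h : N_quot tau) : exists g : N_quot sigma, N_proj tau g = h.
Proof.
exists (coset (N_sub sigma) (fingroup.repr h)).
by rewrite N_proj_coset coset_reprK.
Qed.

End Projection.

Lemma N_proj_comp sigma tau rho (g : N_quot sigma) :
    N_sub sigma \subset N_sub tau -> N_sub tau \subset N_sub rho ->
  N_proj rho (N_proj tau g) = N_proj rho g.
Proof.
move=> st tr; rewrite -(coset_reprK g) !N_proj_coset //.
exact: fintype.subset_trans tr.
Qed.

Lemma chainP c c' :
  (forall sigma, chain_at sigma c = chain_at sigma c') -> c = c'.
Proof.
move=> cc'; apply/ffunP => -[sigma t].
by have /ffunP/(_ t) := cc' sigma; rewrite !ffunE.
Qed.

Lemma chain_at_boundary tau c : chain_at tau (boundary Sigma c) =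
  \sum_(sigma | `[< is_facet sigma tau >])
     galg_push (N_proj tau) (chain_at sigma c).
Proof.
apply/ffunP => t; rewrite ffunE lfunE ffunE galg_sumE.
by apply: eq_bigr.
Qed.

(** The composite projection depends only on the outer cones, so each term occurs as often as there
    are intermediate cones, an even number of times. *)
Lemma boundary2_eq0 :
    (forall sigma rho, ~~ odd #|[set tau : cone Sigma |
       `[< is_facet sigma tau >] && `[< is_facet tau rho >]]%SET|) ->
  forall c, boundary Sigma (boundary Sigma c) = 0.
Proof.
move=> even c; apply: chainP => rho.
rewrite chain_at_boundary linear0.
transitivity (\sum_(tau | `[< is_facet tau rho >])
    \sum_(sigma | `[< is_facet sigma tau >])
      galg_push (N_proj rho) (chain_at sigma c) : galg 'F_2 (N_quot rho)).
  apply: eq_bigr => tau /asboolP tr; rewrite chain_at_boundary linear_sum.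
  apply: eq_bigr => sigma /asboolP st; rewrite /= galg_push_comp.
  by apply: galg_push_eq => g /=; rewrite N_proj_comp // N_sub_sub.
rewrite (exchange_big_dep xpredT) //= big1 // => sigma _.
rewrite sumr_const -(odd_double_half #|_|).
rewrite (_ : odd _ = false); last first.
  apply/negbTE; have := even sigma rho; congr (~~ odd _).
  by apply: eq_card => tau; rewrite finset.inE unfold_in andbC.
by rewrite add0n -mul2n mulrnA galg_mulr2n_eq0 mul0rn.
Qed.

Lemma chain_filt_mono p p' j : p <= p' ->
  (chain_filt Sigma p j <= chain_filt Sigma p' j)%VS.
Proof.
move=> pp'; apply/subvP => c /mem_chain_filt cp; apply/mem_chain_filt => sigma.
have := cp sigma; case: ifP => // _; apply: subvP.
by apply: aug_ideal_pow_anti; rewrite lerD2l lerN2.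
Qed.

(** The new chain discards all monomials of degree < d - p'. The first hypothesis says that the
    discarded parts have boundary 0; its premise concerns all cones [tau'] of the given dimension,
    because the step from the zero cone uses all projections at once. *)
Lemma chain_strict (k : forall sigma, coords (N_quot sigma)) (p p' j : int) c :
    (forall tau (n : nat), (cone_dim tau)%:Z = d%:Z - (j - 1) ->
       (forall tau', (cone_dim tau')%:Z = d%:Z - (j - 1) ->
          chain_at tau' (boundary Sigma c) \in
            aug_ideal_pow 'F_2 (N_quot tau') n%:Z) ->
     \sum_(sigma | `[< is_facet sigma tau >])
        galg_push (N_proj tau) (clow (k sigma) n (chain_at sigma c)) = 0) ->
    c \in chain_filt Sigma p j ->
    boundary Sigma c \in chain_filt Sigma p' (j - 1) ->
  exists2 c', c' \in chain_filt Sigma p' j & boundary Sigma c' = boundary Sigma c.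
Proof.
move=> low0 /mem_chain_filt cj /mem_chain_filt bc.
have c0 sigma : (cone_dim sigma)%:Z != d%:Z - j -> chain_at sigma c = 0.
  by move=> sj; have := cj sigma; rewrite (negPf sj) => /eqP.
(* For d - p' <= 0 the ideal power is the whole algebra and [c] itself serves. *)
have [k0|k0] := lerP (d%:Z - p') 0.
  exists c => //; apply/mem_chain_filt => sigma.
  case: ifP => sj; last by rewrite c0 ?sj.
  by rewrite /aug_ideal_pow k0 memvf.
pose n := `|d%:Z - p'|%N; have nE : d%:Z - p' = n%:Z by rewrite gez0_abs ?ltW.
pose c' : chain Sigma :=
  [ffun x : cell Sigma => ctrunc (k (tag x)) n (chain_at (tag x) c) (tagged x)].
have c'E sigma : chain_at sigma c' = ctrunc (k sigma) n (chain_at sigma c).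
  by apply/ffunP => t; rewrite !ffunE.
exists c'.
  apply/mem_chain_filt => sigma; rewrite c'E; case: ifP => sj.
    by rewrite nE mem_ctrunc.
  by rewrite c0 ?sj // ctrunc0.
apply: chainP => tau; rewrite !chain_at_boundary; apply/esym/eqP.
rewrite -subr_eq0 -sumrB; apply/eqP.
transitivity (\sum_(sigma | `[< is_facet sigma tau >])
    galg_push (N_proj tau) (clow (k sigma) n (chain_at sigma c))
      : galg 'F_2 (N_quot tau)).
  apply: eq_bigr => sigma _; rewrite c'E.
  by rewrite {1}(ctrunc_clow (k sigma) n (chain_at sigma c)) linearD /= addrAC subrr add0r.
have [tj|tj] := eqVneq (cone_dim tau)%:Z (d%:Z - (j - 1)); last first.
  rewrite big1 // => sigma /asboolP [_ dst].
  rewrite c0; last by apply: contra tj => /eqP dj; apply/eqP; rewrite dst; lia.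
  by rewrite /clow big1 ?linear0 // => T _; rewrite linear0 scale0r.
by apply: low0 => // tau' tj'; have := bc tau'; rewrite tj' eqxx nE.
Qed.

End ToricChains.

(** * The chain complex of a reflexive polytope with regular face fan *)

Section ReflexiveToricComplex.
Variables (R : realType) (d : nat) (s' : seq 'rV[int]_d).
Let s := map (@lat_real R 1 d) s'.
Let P := conv_hull s.
Hypotheses (P0 : (P^° 0)%classic) (Ppolar : lattice_polytope (polar P)).
Hypothesis P_regular : forall C, face_fan P C -> Z2_regular C.
Local Notation fan := (normal_fan P).
Local Notation I := 'I_(size s).
Implicit Types (sigma tau rho : cone fan) (u v w : 'cV[R]_d).

Let s_gt0 : (0 < size s)%N := size_gt0 P0.

Let finite_fan : finite_set fan.
Proof. by apply: finite_normal_fan; exists s'. Qed.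

Lemma cone_argmin sigma : exists u, cone_set sigma = ncone (argmin s u).
Proof.
apply/(normal_fanE s_gt0); have := valP sigma.
by rewrite /= in_fset_set // inE.
Qed.

Lemma argmin_cone u : exists sigma : cone fan, cone_set sigma = ncone (argmin s u).
Proof.
have uP : ncone (argmin s u) \in fset_set fan.
  by rewrite in_fset_set // inE; apply/(normal_fanE s_gt0); exists u.
by exists [` uP]%fset.
Qed.

Lemma cone_dimE sigma u : cone_set sigma = ncone (argmin s u) ->
  cone_dim sigma = \dim (dirspace (argmin s u)).
Proof. by rewrite /cone_dim => ->; rewrite /Defs.dim_span linspan_ncone. Qed.

Lemma is_facetE sigma tau u w :
    cone_set sigma = ncone (argmin s u) -> cone_set tau = ncone (argmin s w) ->
  is_facet sigma tau <-> argmin s w \subset argmin s u /\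
    \dim (dirspace (argmin s w)) = (\dim (dirspace (argmin s u))).+1.
Proof.
move=> su tw; rewrite /is_facet (cone_dimE su) (cone_dimE tw) su tw.
by split=> -[/(is_face_ncone s_gt0)].
Qed.

Lemma even_intermediate sigma rho : ~~ odd #|[set tau : cone fan |
  `[< is_facet sigma tau >] && `[< is_facet tau rho >]]%SET|.
Proof.
set S : {set cone fan} := [set tau | _]%SET.
have [us sE] := cone_argmin sigma; have [ur rE] := cone_argmin rho.
have [->|[tau]] := set_0Vmem S; first by rewrite cards0.
rewrite finset.inE => /andP[/asboolP st /asboolP tr].
have [v vE] := cone_argmin tau.
have [BV dB] := (is_facetE vE rE).1 tr; have [VA dA] := (is_facetE sE vE).1 st.
have BA := fintype.subset_trans BV VA; rewrite dA in dB.
have [v1 [v2 [v12 vP]]] := diamond s_gt0 BA dB.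
have [t1 t1E] := argmin_cone v1; have [t2 t2E] := argmin_cone v2.
have t12 : t1 != t2.
  by apply: contra v12 => /eqP t; apply/eqP/ncone_inj; rewrite -t1E -t2E t.
suff -> : S = [set t1; t2]%SET by rewrite cards2 t12.
have tP t w wi (ti : cone fan) : cone_set t = ncone (argmin s w) ->
    cone_set ti = ncone (argmin s wi) -> (t == ti) = (argmin s w == argmin s wi).
  move=> tE tiE; apply/eqP/eqP => [tt|ww].
    by apply: ncone_inj; rewrite -tE -tiE tt.
  by apply: val_inj; rewrite /= -/(cone_set t) tE ww -tiE.
apply/setP => t; have [w wE] := cone_argmin t.
rewrite finset.in_set2 (tP _ _ _ _ wE t1E) (tP _ _ _ _ wE t2E) finset.in_set.
apply/andP/orP => [[/asboolP /(is_facetE sE wE)[wA dw]]|wv].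
  move=> /asboolP /(is_facetE wE rE)[Bw _].
  by have [|/eqP|/eqP] := (vP w).1; [split|left|right].
have [Bw wA dw] : [/\ argmin s ur \subset argmin s w,
    argmin s w \subset argmin s us & \dim (dirspace (argmin s w)) =
    (\dim (dirspace (argmin s us))).+1].
  by apply/vP; case: wv => /eqP; [left|right].
split; apply/asboolP; first exact/(is_facetE sE wE).
by apply/(is_facetE wE rE); rewrite dw.
Qed.

Lemma argmin_neqT sigma u : cone_set sigma = ncone (argmin s u) ->
  cone_dim sigma != 0%N -> argmin s u != finset.setT.
Proof.
move=> sE; rewrite (cone_dimE sE); apply: contra => /eqP ->.
by rewrite (dirspace_setT P0) dimv0.
Qed.

Lemma cone_dim0_uniq sigma tau :
  cone_dim sigma = 0%N -> cone_dim tau = 0%N -> sigma = tau.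
Proof.
have dim0 (rho : cone fan) : cone_dim rho = 0%N -> cone_set rho = [set 0]%classic.
  move=> r0; have [u uE] := cone_argmin rho; apply/seteqP; split=> x.
    move=> xr; have : x \in linspan (cone_set rho) by apply: mem_linspan.
    by move/eqP: r0; rewrite /cone_dim dimv_eq0 => /eqP ->; rewrite memv0 => /eqP.
  move=> ->; rewrite uE; apply/fintype.subsetP => i _; apply/argminP => j.
  by rewrite /ev !linear0.
by move=> /dim0 s0 /dim0 t0; apply: val_inj; rewrite /= -/(cone_set sigma) s0 -t0.
Qed.

(** The vertices are ordered by their indices, the same order for all cones. The first half is
    applied to the source of a projection, the second to its target. *)
Definition adapted u (N : {group 'cV['F_2]_d}) (k : coords (coset_of N)) :=
  let thr := threshold (vertices R s' :&: argmin s u)%SET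
    (fun i => fpair (gen i)) in
  (forall i, exists t, thr N (@cbas _ k i) t) /\
  (forall g t, thr N g t -> g = 1%g \/ exists i, g = @cbas _ k i).

Lemma adapted_coords sigma u : cone_set sigma = ncone (argmin s u) ->
    cone_dim sigma != 0%N ->
  exists k : coords (N_quot sigma), adapted u (N := N_sub_group sigma) k.
Proof.
move=> sE s0; have uT := argmin_neqT sE s0.
have Creg := P_regular (face_fan_cone P0 uT).
apply: threshold_coords.
- by move=> i a b; apply: fpairDr.
- move=> a; rewrite finset.inE sE.
  apply: (iffP (mem_span_mod2_ncone P0 Ppolar uT Creg a)) => h i j.
    by rewrite !finset.in_setI => /andP[iv iu] /andP[jv ju]; apply: h.
  by move=> iu iv ju jv; apply: h; rewrite finset.in_setI ?iv ?jv.
- move=> t; have [a aP] := fpair_vertices P0 Ppolar uT Creg t.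
  by exists a => i; rewrite finset.in_setI => /andP[iv iu]; apply: aP.
Qed.

(** The conditions on kernels in [push_clow_top_eq0], for the projections from the zero cone to the
    rays. *)
Definition top_adapted sigma (k : coords (N_quot sigma)) :=
  exists Y : {set cidx k},
    (forall i, i \in Y -> exists2 tau, is_facet sigma tau &
       forall g, N_proj tau g = 1%g -> g = 1%g \/ g = @cbas _ k i) /\
    (forall tau, is_facet sigma tau -> (forall g : N_quot sigma, N_proj tau g = 1%g -> g = 1%g) \/
       exists z, [/\ z != 1%g, N_proj tau z = 1%g &
         forall i, i \notin Y -> @cfun _ k i z = 0]).

(** Integral vectors on one line have vanishing 2 by 2 minors, also after reduction mod 2, and
    proportional nonzero vectors over F_2 coincide. *)
Lemma span_mod2_dim1 (C : set 'cV[R]_d) x y : Defs.dim_span C = 1%N ->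
  x \in span_mod2 C -> y \in span_mod2 C -> x != 0 -> y != 0 -> x = y.
Proof.
move=> dC /mem_span_mod2[v vC ->] /mem_span_mod2[w wC ->] v0 w0.
have vw i j : v i 0 * w j 0 = v j 0 * w i 0.
  have vR : lat_real R v != 0.
    apply: contra v0 => /eqP v0; rewrite (_ : v = 0) ?/lat_mod2 ?map_mx0 //.
    by apply: (@lat_real_inj R); rewrite v0 /lat_real map_mx0.
  have /vlineP[c wE] : lat_real R w \in <[lat_real R v]>%VS.
    have /eqP -> : <[lat_real R v]>%VS == linspan C.
      by rewrite eqEdim dim_vline vR /= -/(Defs.dim_span C) dC leqnn andbT -memvE.
    exact: wC.
  have wc k : (w k 0)%:~R = c * (v k 0)%:~R :> R.
    by have /matrixP/(_ k 0) := wE; rewrite !mxE.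
  by apply: (@intr_inj R); rewrite !intrM !wc; ring.
have vw2 i j : lat_mod2 v i 0 * lat_mod2 w j 0 = lat_mod2 v j 0 * lat_mod2 w i 0.
  by rewrite !mxE -!intrM vw.
have nz (z : 'cV['F_2]_d) : z != 0 -> exists i, z i 0 = 1.
  move=> z0; apply: contrapT => nz; case/negP: z0; apply/eqP/colP => i.
  by rewrite [RHS]mxE; case: (F2P (z i 0)) => // zi; case: nz; exists i.
have [i vi] := nz _ v0; have [j wj] := nz _ w0.
have wi : lat_mod2 w i 0 = 1.
  have := vw2 i j; rewrite vi wj mulr1.
  by case: (F2P (lat_mod2 w i 0)) => // ->; rewrite mulr0.
by apply/colP => l; have := vw2 i l; rewrite vi wi mul1r mulr1.
Qed.

Lemma top_coords sigma : cone_dim sigma = 0%N ->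
  exists k : coords (N_quot sigma), top_adapted k.
Proof.
move=> s0.
have N0 a : a \in N_sub_group sigma -> a = 0.
  rewrite finset.inE => /mem_span_mod2[v vs ->].
  have v0 : lat_real R v = 0.
    apply/eqP; rewrite -memv0; move/eqP: s0.
    by rewrite /cone_dim dimv_eq0 => /eqP <-.
  rewrite (_ : v = 0) ?/lat_mod2 ?map_mx0 //.
  by apply: (@lat_real_inj R); rewrite v0 /lat_real map_mx0.
(* The nonzero vectors of the [N_sub tau], tau a ray; by [span_mod2_dim1] each ray contributes at
   most one. *)
pose X := [seq x <- enum {: 'cV['F_2]_d} | (x != 0) &&
  [exists tau : cone fan, `[< is_facet sigma tau >] && (x \in N_sub tau)]].
have XP x : reflect (x != 0 /\ exists2 tau, is_facet sigma tau & x \in N_sub tau)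
    (x \in X).
  rewrite mem_filter mem_enum andbT; apply: (iffP andP) => -[x0].
    by move=> /existsP[tau /andP[/asboolP st xt]]; split=> //; exists tau.
  by move=> [tau st xt]; split=> //; apply/existsP; exists tau; rewrite xt andbT; apply/asboolP.
have [k [Y [YX XY]]] := spanning_coords X N0.
have ker (tau : cone fan) (st : is_facet sigma tau) a :
    N_proj tau (coset (N_sub sigma) a) = 1%g -> a \in N_sub tau.
  move=> a1; rewrite -[N_sub tau]/(gval (N_sub_group tau)) -coset_eq1 -a1.
  by rewrite N_proj_coset // N_sub_sub.
have dim1 (tau : cone fan) : is_facet sigma tau ->
    {in N_sub tau &, forall x y, x != 0 -> y != 0 -> x = y}.
  move=> [_ dt] x y; rewrite !finset.inE => xt yt.
  by apply: span_mod2_dim1 xt yt; rewrite -/(cone_dim tau) dt s0.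
have one a : a = 0 -> coset (N_sub sigma) a = 1%g.
  by move=> ->; apply/eqP; rewrite (coset_eq1 (N_sub_group sigma)) (group1 (N_sub_group sigma)).
exists k, Y; split=> [i iY|tau st].
  have [x /XP[x0 [tau st xt]] bx] := YX i iY; exists tau => // g.
  rewrite -(coset_reprK g) bx => /(ker _ st) at0.
  have [r0|r0] := eqVneq (fingroup.repr g) 0; first by left; apply: one.
  by right; rewrite (dim1 _ st _ _ at0 xt r0 x0).
have [triv|nt] := pselect (forall a, a \in N_sub tau -> a = 0).
  by left=> g; rewrite -(coset_reprK g) => /(ker _ st)/triv; apply: one.
right; have [x xt x0] : exists2 x, x \in N_sub tau & x != 0.
  apply: contrapT => nx; apply: nt => a at0; apply/eqP/negPn/negP => a0.
  by apply: nx; exists a.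
exists (coset (N_sub sigma) x); split.
- rewrite (coset_eq1 (N_sub_group sigma)); apply: contra x0 => /N0 ->.
  exact: eqxx.
- by rewrite N_proj_coset ?N_sub_sub //; apply: coset_id.
- by move=> i iY; apply: XY => //; apply/XP; split=> //; exists tau.
Qed.

Lemma toric_strict (p p' j : int) (c : chain fan) :
    c \in chain_filt fan p j ->
    boundary fan c \in chain_filt fan p' (j - 1) ->
  exists2 c', c' \in chain_filt fan p' j & boundary fan c' = boundary fan c.
Proof.
have /choice[u uE] := cone_argmin.
have ex sigma : exists k : coords (N_quot sigma),
    (cone_dim sigma != 0%N -> adapted (u sigma) (N := N_sub_group sigma) k) /\
    (cone_dim sigma = 0%N -> top_adapted k).
  have [s0|s0] := eqVneq (cone_dim sigma) 0%N.
    by have [k kP] := top_coords s0; exists k.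
  have [k kP] := adapted_coords (uE sigma) s0; exists k; split=> // s00.
  by rewrite s00 in s0.
pose k sigma := sval (cid (ex sigma)).
apply: (chain_strict (k := k)) => tau n tj bn.
have fM (sigma tau' : cone fan) : is_facet sigma tau' ->
    {morph N_proj tau' : g h / (g * h)%g : N_quot sigma >-> (g * h)%g}.
  by move=> /N_sub_sub; apply: N_projM.
(* A ray receives only from the zero cone, with its own coordinates; every facet of a higher cone is
   nonzero and has threshold coordinates. *)
have [tau1|tau1] := eqVneq (cone_dim tau) 1%N.
  apply: big1 => sigma /asboolP st.
  have s0 : cone_dim sigma = 0%N by case: st => _; rewrite tau1 => -[].
  have [_ /(_ s0)[Y [Y1 Y2]]] := svalP (cid (ex sigma)).
  apply: (@push_clow_top_eq0 _ (k sigma) (cone fan)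
    (fun tau' => `[< is_facet sigma tau' >]) _ _ Y) => //.
  - by move=> tau' /asboolP; apply: fM.
  - by move=> tau' h /asboolP/N_sub_sub st'; apply: N_proj_surj.
  - move=> i /Y1[tau' st' h]; exists tau' => //; exact/asboolP.
  - by move=> tau' /asboolP; apply: Y2.
  - move=> tau' /asboolP st'.
    have t'1 : cone_dim tau' = cone_dim tau by rewrite tau1; case: st' => _ ->; rewrite s0.
    have := bn tau'; rewrite t'1 => /(_ tj).
    (* The zero cone is the only facet of the ray [tau'], so the boundary there is a single
       push-forward. *)
    rewrite chain_at_boundary (bigD1 sigma) /=; last exact/asboolP.
    rewrite big1 ?addr0 // => sigma' /andP[/asboolP[_ d'] /eqP[]].
    by apply: cone_dim0_uniq => //; move: d'; rewrite t'1 tau1 => -[].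
  - exact/asboolP.
have dimS sigma : is_facet sigma tau -> cone_dim sigma != 0%N.
  by move=> [_ dt]; apply: contra tau1 => /eqP s0; rewrite dt s0.
have [t0|t0] := eqVneq (cone_dim tau) 0%N.
  by apply: big1 => sigma /asboolP[_]; rewrite t0.
have [kt _] := svalP (cid (ex tau)); have [_ tK] := kt t0.
apply: (@push_clow_eq0 _ _ _ _ k (k tau)).
- by move=> sigma /asboolP; apply: fM.
- move=> sigma i /asboolP st; have [ks _] := svalP (cid (ex sigma)).
  have [/(_ i)[t [a aE at_]] _] := ks (dimS _ st).
  (* The vertices of the face dual to [tau] are among those dual to [sigma], so the same vector [a]
     is a threshold vector for [tau]. *)
  apply: (tK _ t); exists a; first by rewrite aE N_proj_coset // N_sub_sub.
  have [/fintype.subsetP tsub _] := (is_facetE (uE sigma) (uE tau)).1 st.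
  by move=> l; rewrite !finset.in_setI => /andP[lv /tsub lu]; apply: at_; rewrite finset.in_setI lv.
- by have := bn tau tj; rewrite chain_at_boundary.
Qed.

End ReflexiveToricComplex.

Local Open Scope classical_set_scope.
Local Open Scope ring_scope.

Theorem mainTheorem3 (R : realType) (d : nat) (Delta : set 'rV[R]_d) :
  reflexive_polytope Delta ->
  (forall sigma : set 'rV[R]_d, face_fan Delta sigma -> Z2_regular sigma) ->
  forall r p q : int, 1 <= r ->
    forall x : Ebar (normal_fan Delta) r p q, dbar x = 0.
Proof.
move=> [[s' DE] int0 pol0] reg r p q r1 x; rewrite DE in int0 pol0 reg x *.
apply: ss_d_eq0 => //.
- apply: boundary2_eq0 => sigma rho; exact: even_intermediate.
- by move=> a b n ab; apply: chain_filt_mono.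
- by move=> c cF bF; apply: toric_strict cF bF.
- by lia.
- by lia.
Qed.
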